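(* Let $0<s<1/3$ and $1<p<3/2$ be such that $\left(\tfrac23+s\right)p<1$, and let $\alpha>0$ be fixed with $\alpha<\min\{(1+s)/6,\ s/5\}$. Let $X:=\mathcal{A}\cap W^{1+s,p}(0,1)$. Then the functionals $J_h^\alpha$ (defined on $X_h$) $\Gamma$-converge to $J$ (defined on $X$) as $h\to0^+$ with respect to the strong $W^{1,p}(0,1)$-topology, i.e.: (i) (lim-inf property) if $\{v_h\}_{h>0}$ with $v_h\in X_h$ is such that $v_h\to v$ strongly in $W^{1,p}(0,1)$, then $\liminf_{h\to0^+}J_h^\alpha(v_h)\ge J(v)$; (ii) (recovery sequence property) for every $v\in X$ there exists a family $\{v_h\}_{h>0}$ with $v_h\in X_h$ such that $v_h\to v$ strongly in $W^{1,p}(0,1)$ and $\limsup_{h\to0^+}J_h^\alpha(v_h)\le J(v)$.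
   Context: Manià's functional is $J(v):=\int_0^1 v'(x)^6\,(v(x)^3-x)^2\,dx$, and the admissible set is $\mathcal{A}:=\{u\in W^{1,1}(0,1): u(0)=0,\ u(1)=1,\ J(u)<\infty\}$. For $0<s<1$ and $1\le p<\infty$, $W^{1+s,p}(0,1)$ is the set of $u\in L^p(0,1)$ with weak derivative $u'\in W^{s,p}(0,1)$, where $w\in W^{s,p}(0,1)$ means $w\in L^p(0,1)$ and $\int_0^1\int_0^1\frac{|w(x)-w(y)|^p}{|x-y|^{1+sp}}\,dx\,dy<\infty$. For an integer $N\ge1$ let $h=1/N$, $x_j=jh$ ($0\le j\le N$), $I_k=(x_k,x_{k+1})$. The finite element space is $X_h:=\{v_h\in C([0,1]): v_h|_{I_k}\text{ is affine for all }0\le k\le N-1,\ v_h(0)=0,\ v_h(1)=1\}$. The limit $h\to0^+$ is along $h=1/N$. The cut-off function is $\chi_h^\alpha(t):=\operatorname{sgn}(t)\min\{|t|,h^{-\alpha}\}$ for $t\in\mathbb{R}$, and the approximate functional is $J_h^\alpha(v):=\int_0^1\left(\chi_h^\alpha(v'(x))\right)^6(v(x)^3-x)^2\,dx$. *)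

(* Defs.v *)
(* MathComp-Analysis development over an arbitrary R : realType.

   A function on (0,1) or [0,1] is a function R -> R whose values outside the
   interval are irrelevant.  An element of W^{1,1}(0,1) is an equivalence class
   modulo a.e. equality; wherever pointwise values matter (the boundary values
   in [admissible]) it is given by its continuous representative on [0,1]. *)
From mathcomp Require Import all_boot all_order all_algebra.
From mathcomp Require Import all_classical all_reals all_analysis.

Set Implicit Arguments.
Unset Strict Implicit.
Unset Printing Implicit Defensive.

Import Order.TTheory GRing.Theory Num.Theory.
Import numFieldNormedType.Exports.

Local Open Scope classical_set_scope.
Local Open Scope ring_scope.

Section Sobolev.
Context {R : realType}.
Implicit Types (u v w phi : R -> R) (s p : R).

Notation mu := (@lebesgue_measure R).

Definition I01 : set R := `]0, 1[.

(* phi \in C_c^\infty(0,1), extended by zero to the real line *)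
Definition test_function phi : Prop :=
  [/\ forall n x, derivable (derive1n n phi) x 1,
      compact (closure [set x | phi x != 0]) &
      closure [set x | phi x != 0] `<=` I01].

Definition is_weak_derivative u w : Prop :=
  [/\ locally_integrable I01 u, locally_integrable I01 w &
      forall phi, test_function phi ->
        \int[mu]_(x in I01) (u x * derive1 phi x) =
        - \int[mu]_(x in I01) (w x * phi x)].

(* A representative of the weak derivative, which is unique up to a.e.
   equality on (0,1); the value is arbitrary if there is no weak derivative. *)
Definition wderiv u : R -> R := get [set w | is_weak_derivative u w].

Definition Lp_norm p u : \bar R := 'N[mu]_p%:E [EFin \o (u \_ I01)].

Definition in_Lp p u : Prop := (u \_ I01) \in Lfun mu p%:E.

Definition in_W1p p u : Prop :=
  in_Lp p u /\ exists2 w, is_weak_derivative u w & in_Lp p w.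

Definition W1p_norm p u : \bar R := (Lp_norm p u + Lp_norm p (wderiv u))%E.

(* On the diagonal x = y the integrand is 0, since x / 0 = 0. *)
Definition gagliardo s p w : \bar R :=
  (\int[mu]_(x in I01) \int[mu]_(y in I01)
     ((`|w x - w y| `^ p) / (`|x - y| `^ (1 + s * p)))%:E)%E.

Definition in_Wsp s p w : Prop := in_Lp p w /\ (gagliardo s p w < +oo)%E.

(* the space W^{1+s,p}(0,1), for 0 < s < 1 *)
Definition in_W1sp s p u : Prop :=
  in_Lp p u /\ exists2 w, is_weak_derivative u w & in_Wsp s p w.

End Sobolev.

Section Mania.
Context {R : realType}.
Implicit Types (u v : R -> R) (s p alpha h t : R) (N : nat).

Notation mu := (@lebesgue_measure R).

Definition J v : \bar R :=
  (\int[mu]_(x in I01) ((wderiv v x) ^+ 6 * (v x ^+ 3 - x) ^+ 2)%:E)%E.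

Definition admissible : set (R -> R) :=
  [set u : R -> R | [/\ in_W1p 1 u, {within `[(0 : R), 1], continuous u},
               u 0 = 0, u 1 = 1 & (J u < +oo)%E]].

Definition mesh N : R := N%:R^-1.

Definition fe_space N : set (R -> R) :=
  [set v : R -> R | [/\ {within `[(0 : R), 1], continuous v},
      (forall k, (k < N)%N -> exists a b : R,
        {in `]k%:R * mesh N, k.+1%:R * mesh N[, forall x, v x = a * x + b}),
      v 0 = 0 & v 1 = 1]].

Definition chi h alpha t : R := Num.sg t * Num.min `|t| (h `^ (- alpha)).

Definition Jh h alpha v : \bar R :=
  (\int[mu]_(x in I01)
     ((chi h alpha (wderiv v x)) ^+ 6 * (v x ^+ 3 - x) ^+ 2)%:E)%E.

Definition X s p : set (R -> R) :=
  admissible `&` [set u : R -> R | in_W1sp s p u].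

(* A family (v_h)_{h = 1/N, N >= 1} is indexed by N; its value at N = 0 is
   irrelevant. *)
Definition fe_family (v_ : nat -> R -> R) : Prop :=
  forall N, (0 < N)%N -> fe_space N (v_ N).

Definition cvg_W1p p (v_ : nat -> R -> R) v : Prop :=
  (fun N => W1p_norm p (v_ N \- v)) @ \oo --> 0%E.

End Mania.

(* Main.v *)
Require Import Defs.
From mathcomp Require Import all_boot all_order all_algebra.
From mathcomp Require Import all_classical all_reals all_analysis.
From mathcomp Require Import ring lra.
Import Order.TTheory GRing.Theory Num.Theory.
Import numFieldNormedType.Exports.
Import measurable_realfun.
Local Open Scope classical_set_scope.
Local Open Scope ring_scope.

(** Both halves rest on elementary facts about weak derivatives on (0, 1): they
    are unique almost everywhere ([weak_derivative_unique]), a continuous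
    function is the primitive of its weak derivative when the latter is
    integrable ([weak_derivative_FTC]), and a continuous piecewise affine
    function has its slopes as weak derivative ([fe_weak_derivative]).  The
    first two come from one family of test functions, smooth bumps that
    increase to the indicator of an interval (a, b) and whose derivatives
    therefore act in the limit like a Dirac mass at a minus one at b.

    Lim-inf inequality ([mania_liminf]).  Convergence in W^{1,p} gives, along a
    fast subsequence, almost everywhere convergence of values and slopes.  The
    cut-off level h^(-alpha) tends to infinity, so at almost every point the
    cut-off is eventually inactive and the energy densities converge to the
    density of J; Fatou's lemma concludes.

    Recovery sequence.  Take v_h to be the nodal interpolant of v.  Its slope on
    an element is the mean of w = v' there.  Jensen's inequality on each element
    together with |x - y| <= h bounds the L^p norm of v_h' - w by a constant
    times h^s times the fractional seminorm of w ([meanstep_Lp]).  Hence v_h'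
    approaches w at rate h^s in L^1; as v_h - v vanishes at the nodes, v_h
    approaches v at rate h^(1+s) in L^1 ([interp_err_L1]).

    For the energies write chi for the cut-off.  Since |chi(w)| <= |w|,
       J_h(v_h) - J(v) <= int chi(v_h')^6 ((v_h^3 - x)^2 - (v^3 - x)^2)
                          + int (chi(v_h')^6 - chi(w)^6) (v^3 - x)^2.
    The cut-off is bounded by h^(-alpha) and 1-Lipschitz, so the two integrals
    are O(h^(-6 alpha) h^(1+s)) and O(h^(-5 alpha) h^s) ([interp_energy_le]).
    Both bounds tend to 0 exactly when alpha < (1+s)/6 and alpha < s/5. *)

(** * Smooth functions *)

Section Smooth.
Context {R : realType}.
Implicit Types (f g df : R -> R) (Q : {poly R}) (n : nat).

(** Differentiability up to order [n] as a recursion on the derivative, so that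
    products go through by induction: (f g)' = f g' + g f' only involves
    functions that are known to be one order less differentiable. *)
Fixpoint diffn n f : Prop :=
  (forall x : R, derivable f x 1) /\
  (if n is m.+1 then diffn m (derive1 f) else True).

Definition smooth f := forall n, diffn n f.

Lemma smooth_derivable1n f : smooth f ->
  forall n (x : R), derivable (derive1n n f) x 1.
Proof.
move=> sf n; have := sf n; elim: n f {sf} => [f []//|n IH f [_ /IH]].
by rewrite derive1Sn.
Qed.

Lemma diffnW n f : diffn n.+1 f -> diffn n f.
Proof. by elim: n f => [f []//|n IH f [df /IH]]; split. Qed.

Lemma derive1_eq f df : (forall x : R, is_derive x 1 f (df x)) -> (derive1 f) = df.
Proof. by move=> H; apply/funext => x; rewrite derive1E; apply: derive_val. Qed.

Lemma is_derive_diffn n f df : (forall x : R, is_derive x 1 f (df x)) ->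
  diffn n df -> diffn n.+1 f.
Proof.
move=> H dn; split; first by move=> x; apply: ex_derive.
by rewrite (derive1_eq _ _ H).
Qed.

Lemma diffn_is_derive n f : diffn n f -> forall x : R, is_derive x 1 f ((derive1 f) x).
Proof. by case: n => [|n] [df _] x; rewrite derive1E; apply: derivableP. Qed.

Lemma diffnD n f g : diffn n f -> diffn n g -> diffn n (f + g).
Proof.
elim: n f g => [|n IH] f g [df f'] [dg g'].
  by split => // x; apply: derivableD.
apply: (is_derive_diffn _ _ ((derive1 f) + (derive1 g))); last exact: IH.
by move=> x; apply: is_deriveD; rewrite derive1E; apply: derivableP.
Qed.

Lemma diffnM n f g : diffn n f -> diffn n g -> diffn n (f * g).
Proof.
elim: n f g => [|n IH] f g Hf Hg.
  by case: Hf Hg => df _ [dg _]; split => // x; apply: derivableM.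
have df := diffn_is_derive _ _ Hf; have dg := diffn_is_derive _ _ Hg.
apply: (is_derive_diffn _ _ (f * (derive1 g) + g * (derive1 f))).
refine (diffnD n (f * derive1 g) (g * derive1 f) _ _); apply: IH.
- exact: diffnW.
- by case: Hg.
- exact: diffnW.
- by case: Hf.
Qed.

Lemma smooth_horner Q : smooth (horner Q).
Proof.
move=> n; elim: n Q => [|n IH] Q; first by split => // x; apply: derivable_horner.
by apply: is_derive_diffn (IH Q^`()) => x; apply: is_derive_poly.
Qed.

(** Raise 1 + u/n <= exp(u/n) to the power n: then u^n <= n^n exp(u). *)
Lemma exprn_expRN_bounded n : exists C : R, forall u, 0 <= u -> u ^+ n * expR (- u) <= C.
Proof.
exists (n%:R ^+ n) => u u0; rewrite expRN ler_pdivrMr ?expR_gt0//.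
case: n => [|n]; first by rewrite !expr0 mul1r -expR0 ler_expR.
have n0 : (0 : R) < n.+1%:R by rewrite ltr0n.
have -> : expR u = expR (u / n.+1%:R) ^+ n.+1.
  by rewrite -expRM_natl mulrC divfK// gt_eqF.
rewrite -exprMn lerXn2r// ?nnegrE// ?mulr_ge0 ?expR_ge0 ?ler0n//.
rewrite -ler_pdivrMl// mulrC; apply: le_trans (expR_ge1Dx _).
by rewrite lerDr.
Qed.

Lemma horner_expRN_bounded Q : exists C : R, forall u, 0 <= u -> `|Q.[u] * expR (- u)| <= C.
Proof.
have /choice[C HC] := exprn_expRN_bounded.
exists (\sum_(i < size Q) `|Q`_i| * C i) => u u0.
rewrite horner_coef mulr_suml; apply: le_trans (ler_norm_sum _ _ _) _.
apply: ler_sum => i _; rewrite -mulrA normrM ler_wpM2l//.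
by rewrite ger0_norm ?HC// mulr_ge0 ?exprn_ge0 ?expR_ge0.
Qed.

(** The flat function exp(-1/t), with a polynomial factor in 1/t so that the
    family is closed under differentiation. *)
Definition expinv Q (t : R) : R := if 0 < t then Q.[t^-1] * expR (- t^-1) else 0.

Lemma cvg_expinv0 Q : expinv Q x @[x --> (0 : R)] --> (0 : R).
Proof.
have [C HC] := horner_expRN_bounded (Q * 'X).
have C0 : 0 <= C by apply: le_trans (HC 0 _).
have bnd x : `|expinv Q x| <= C * `|x|.
  rewrite /expinv; case: ifPn => x0; last by rewrite normr0 mulr_ge0.
  have := HC x^-1; rewrite invr_ge0 ltW// => /(_ isT).
  rewrite hornerMX mulrAC normrM [X in _ * X]gtr0_norm ?invr_gt0//.
  by rewrite ler_pdivrMr// (gtr0_norm x0).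
apply/cvgrPdist_le => e e0.
have d0 : 0 < e / (C + 1) by rewrite divr_gt0// ltr_wpDl.
exists (e / (C + 1)) => //= x; rewrite !sub0r !normrN => /ltW.
rewrite ler_pdivlMr ?ltr_wpDl// => H; apply: le_trans (bnd x) _.
by apply: le_trans _ H; rewrite sub0r normrN mulrDr mulr1 mulrC lerDl.
Qed.

(** With u = 1/t, the chain rule gives
    d/dt (Q(u) exp(-u)) = (Q(u) - Q'(u)) u^2 exp(-u). *)
Definition expinv' Q : {poly R} := (Q - Q^`()) * 'X^2.

(** The delicate point is t = 0: the difference quotient of [expinv Q] there is
    [expinv (Q * 'X)], which tends to 0 because exp(-u) beats every polynomial
    in u = 1/t. *)
Lemma is_derive_expinv Q (t : R) : is_derive t 1 (expinv Q) (expinv (expinv' Q) t).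
Proof.
have [t0|t0|<-] := ltgtP 0 t.
- have tN0 : t != 0 by rewrite gt_eqF.
  have H : is_derive t 1 ((horner Q \o GRing.inv) * (expR \o (-%R \o GRing.inv)))
     (expinv (expinv' Q) t).
    have dV : is_derive t 1 GRing.inv (- t ^- 2 : R).
      have := @is_deriveV R id t 1 1 tN0 (is_derive_id t 1).
      by rewrite /GRing.scale/= mulr1.
    have dN : is_derive t 1 (-%R \o GRing.inv) (t ^- 2).
      have := is_deriveN dV; rewrite opprK; exact.
    have dQ := @is_derive1_comp _ (horner Q) GRing.inv t _ _ (is_derive_poly _ _) dV.
    have dE := @is_derive1_comp _ expR (-%R \o GRing.inv) t _ _ (is_derive_expR _) dN.
    apply: (is_derive_eq (is_deriveM dQ dE)).
    rewrite /expinv t0 /expinv' !hornerE /GRing.scale/= .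
    rewrite -exprVn; ring.
  apply: near_eq_is_derive H.
  near=> x; rewrite /expinv ifT//.
  by near: x; apply: lt_nbhsr.
- have H := is_derive_cst (0 : R) t 1.
  rewrite /expinv (lt_gtF t0); apply: near_eq_is_derive H.
  near=> x; rewrite /expinv ifF//; apply/negbTE; rewrite -leNgt ltW//.
  by near: x; apply: lt_nbhsl.
- apply/is_derive1_caratheodory; exists (expinv (Q * 'X)); split.
  + move=> z; rewrite [expinv Q 0]/expinv ltxx !subr0 /expinv.
    case: ifPn => z0; last by rewrite mul0r.
    rewrite hornerMX mulrAC -[_ * z^-1 * z]mulrA mulVf ?mulr1// gt_eqF//.
  + rewrite /prop_for /continuous_at [X in _ --> X]/expinv ltxx.
    exact: cvg_expinv0.
  + by rewrite /expinv ltxx.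
Unshelve. all: by end_near. Qed.
End Smooth.

(** * Smooth bumps filling an interval *)

Section Bumps.
Context {R : realType}.
Implicit Types (f g : R -> R) (Q : {poly R}) (n : nat).

Lemma smooth_expinv_comp Q (q : {poly R}) : smooth (expinv Q \o horner q).
Proof.
have dE P x : is_derive x (1 : R) (expinv P \o horner q)
    ((expinv (expinv' P) \o horner q) x * q^`().[x]).
  exact: (@is_derive1_comp R (expinv P) (horner q) x _ _ (is_derive_expinv _ _) (is_derive_poly _ _)).
move=> n; elim: n Q => [|n IH] Q; first by split => // x; apply: ex_derive.
apply: (is_derive_diffn _ _ ((expinv (expinv' Q) \o horner q) * horner q^`())).
by apply: diffnM => //; exact: smooth_horner.
Qed.

Variables (a b : R).
Hypothesis ab : a < b.

Definition bump_arg n : {poly R} := n.+1%:R *: (('X - a%:P) * (b%:P - 'X)).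

(** Composing exp(-1/t) with (n+1)(x - a)(b - x) gives a bump that vanishes
    outside (a, b), increases up to the midpoint and decreases afterwards, and
    tends to 1 at every point of (a, b) as n grows: no plateau has to be
    constructed, and the monotonicity makes its derivative a difference of two
    approximate Dirac masses. *)
Definition bumpfun n : R -> R := expinv 1 \o horner (bump_arg n).

Lemma bump_argE n x : (bump_arg n).[x] = n.+1%:R * ((x - a) * (b - x)).
Proof. by rewrite !hornerE. Qed.

Lemma bump_arg_gt0 x : x \in `]a, b[ -> 0 < (x - a) * (b - x).
Proof. by rewrite in_itv/= => /andP[ax xb]; rewrite mulr_gt0// subr_gt0. Qed.

Lemma bump_arg_le0 n x : x \notin `]a, b[ -> (bump_arg n).[x] <= 0.
Proof.
rewrite bump_argE in_itv/= negb_and -!leNgt => H.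
rewrite mulr_ge0_le0//; have ba := ltW ab.
case/orP: H => H; [rewrite mulr_le0_ge0//|rewrite mulr_ge0_le0//];
  by rewrite ?subr_ge0 ?subr_le0// ?(le_trans H) ?(le_trans _ H).
Qed.

Lemma bumpfun_out n x : x \notin `]a, b[ -> bumpfun n x = 0.
Proof. by move=> /(bump_arg_le0 n) H; rewrite /bumpfun/= /expinv ltNge H. Qed.

Definition dbumpfun n : R -> R :=
  fun x => expinv 'X^2 (bump_arg n).[x] * (n.+1%:R * (a + b - 2 * x)).

Lemma is_derive_bumpfun n (x : R) : is_derive x 1 (bumpfun n) (dbumpfun n x).
Proof.
have := @is_derive1_comp R (expinv 1) (horner (bump_arg n)) x _ _
  (is_derive_expinv 1 _) (is_derive_poly _ _).
rewrite /expinv' derivC subr0 mul1r => H; apply: is_derive_eq.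
rewrite /dbumpfun /bump_arg; congr (_ * _).
rewrite derivZ derivM !derivB !derivX !derivC !hornerE/=. ring.
Qed.

Lemma derive1_bumpfun n : derive1 (bumpfun n) = dbumpfun n.
Proof. by apply: derive1_eq => x; exact: is_derive_bumpfun. Qed.

Lemma dbumpfun_out n x : x \notin `]a, b[ -> dbumpfun n x = 0.
Proof. by move=> /(bump_arg_le0 n) H; rewrite /dbumpfun/= /expinv ltNge H mul0r. Qed.

Lemma bumpfun_ge0 n x : 0 <= bumpfun n x.
Proof. by rewrite /bumpfun/= /expinv; case: ifP => // _; rewrite hornerC mul1r expR_ge0. Qed.

Lemma bumpfun_le1 n x : bumpfun n x <= 1.
Proof.
rewrite /bumpfun/= /expinv; case: ifP => // H; rewrite hornerC mul1r expR_le1.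
by rewrite oppr_le0 invr_ge0 ltW.
Qed.

Lemma bumpfun_cvg x : x \in `]a, b[ -> bumpfun n x @[n --> \oo] --> (1 : R).
Proof.
move=> xab; have := bump_arg_gt0 _ xab.
move cE : (_ * _) => c c0.
have H : expR (- (n.+1%:R^-1 * c^-1)) @[n --> \oo] --> (1 : R).
  rewrite [X in _ --> X](_ : 1 = expR (- (0 / c))); last first.
    by rewrite mul0r oppr0 expR0.
  apply: continuous_cvg; first exact: continuous_expR.
  apply: cvgN; apply: cvgMr_tmp.
  exact: cvg_harmonic.
apply: cvg_trans H; apply: near_eq_cvg; near=> n.
rewrite /bumpfun/= bump_argE /expinv cE ifT; last by rewrite pmulr_rgt0.
by rewrite hornerC mul1r invfM.
Unshelve. all: by end_near. Qed.

Lemma closure_bumpfun n : closure [set x | bumpfun n x != 0] `<=` `[a, b].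
Proof.
rewrite closureE => x; apply; split; first exact: itv_closed.
move=> y /=; apply: contraNT => yab; apply/eqP/bumpfun_out.
by apply: contra yab; rewrite !in_itv/= => /andP[? ?]; rewrite !ltW.
Qed.

Lemma bumpfun_test n : 0 < a -> b < 1 -> test_function (bumpfun n).
Proof.
move=> a0 b1; split.
- by apply: smooth_derivable1n; exact: smooth_expinv_comp.
- apply: (subclosed_compact _ (segment_compact (a := a) (b := b))).
    exact: closed_closure.
  exact: closure_bumpfun.
- move=> x /closure_bumpfun; rewrite /I01/= !in_itv/= => /andP[ax xb].
  by rewrite (lt_le_trans a0 ax) (le_lt_trans xb b1).
Qed.
End Bumps.

(** * Integrals over intervals *)

Section RintegralTools.
Context {R : realType}.
Notation mu := (@lebesgue_measure R).
Implicit Types (f g h : R -> R) (D : set R).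

Lemma integrable_mul_bounded D f h (M : R) : measurable D ->
  mu.-integrable D (EFin \o f) -> measurable_fun D h ->
  (forall x, D x -> `|h x| <= M) ->
  mu.-integrable D (EFin \o (fun x => f x * h x)).
Proof.
move=> mD fi mh hM; have := @integrableMl _ _ _ mu D mD (EFin \o f) h fi mh.
apply; exists M; split; first exact: num_real.
by move=> y My x Dx; apply: le_trans (hM x Dx) (ltW My).
Qed.

Lemma integrable_scale D f (k : R) : measurable D ->
  mu.-integrable D (EFin \o f) -> mu.-integrable D (EFin \o (fun x => k * f x)).
Proof.
by move=> mD fi; exact: (@integrableZl _ _ _ mu D mD k _ fi).
Qed.

Lemma integrable_add D f g : measurable D ->
  mu.-integrable D (EFin \o f) -> mu.-integrable D (EFin \o g) ->
  mu.-integrable D (EFin \o (fun x => f x + g x)).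
Proof. by move=> mD fi gi; exact: (@integrableD _ _ _ mu D mD _ _ fi gi). Qed.

Lemma integrable_sub D f g : measurable D ->
  mu.-integrable D (EFin \o f) -> mu.-integrable D (EFin \o g) ->
  mu.-integrable D (EFin \o (fun x => f x - g x)).
Proof. by move=> mD fi gi; exact: (@integrableB _ _ _ mu D mD _ _ fi gi). Qed.

Lemma within_continuous_bounded f (a b : R) : {within `[a, b], continuous f} ->
  exists2 M, 0 <= M & forall x, x \in `[a, b] -> `|f x| <= M.
Proof.
move=> cf; have := compact_bounded (continuous_compact cf (@segment_compact _ a b)).
move=> [M [_ HM]]; exists (`|M| + 1); first by rewrite addr_ge0.
move=> x xab; apply: (HM (`|M| + 1)).
  by rewrite (le_lt_trans (ler_norm M))// ltrDl.
by exists x.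
Qed.

Lemma within_continuous_integrable f (a b : R) : {within `[a, b], continuous f} ->
  mu.-integrable `[a, b] (EFin \o f).
Proof.
by apply: continuous_compact_integrable; exact: segment_compact.
Qed.

Lemma within_continuous_measurable f (a b : R) : {within `[a, b], continuous f} ->
  measurable_fun `[a, b] f.
Proof. by apply: subspace_continuous_measurable_fun. Qed.

Lemma Rintegral_support D E f : E `<=` D ->
  (forall x, D x -> ~ E x -> f x = 0) ->
  (\int[mu]_(x in D) f x = \int[mu]_(x in E) f x)%R.
Proof.
move=> ED f0; rewrite Rintegral_mkcond [RHS]Rintegral_mkcond.
apply: eq_Rintegral => x _; rewrite !patchE; case: ifPn => xD; case: ifPn => // xE.
  by apply: f0; [exact: set_mem|by move=> Ex; rewrite mem_set in xE].
by move: xD; rewrite mem_set//; apply: ED; exact: set_mem.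
Qed.

Lemma derivable_continuous f : (forall x : R, derivable f x 1) -> continuous f.
Proof. by move=> df x; apply/differentiable_continuous/derivable1_diffP. Qed.

Lemma Rintegral_derive f df (x y : R) : x <= y ->
  (forall t : R, is_derive t 1 f (df t)) -> continuous df ->
  (\int[mu]_(t in `[x, y]) df t)%R = f y - f x.
Proof.
rewrite le_eqVlt => /predU1P[->|xy] Hf cdf.
  by rewrite set_itv1 Rintegral_set1 subrr.
have cf : continuous f by apply: derivable_continuous => t; apply: ex_derive.
rewrite /Rintegral (continuous_FTC2 (F := f) xy)//.
- exact: continuous_subspaceT.
- split.
  + by move=> t _; apply: ex_derive.
  + by apply: cvg_at_right_filter; apply: cf.
  + by apply: cvg_at_left_filter; apply: cf.
- by move=> t _; rewrite derive1E; apply: derive_val.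
Qed.

End RintegralTools.

(** * Dirac sequences *)

Section DiracSequence.
Context {R : realType}.
Notation mu := (@lebesgue_measure R).

(** The integral of (v - v e) psi is at most the oscillation of v near e times
    the mass of psi, plus twice the supremum of |v| times the mass away from e.
    The far region is left to the caller as a set [A], so that it can be chosen
    as an interval on which the mass is computed by the fundamental theorem of
    calculus. *)
Lemma dirac_sequence_cvg (psi : nat -> R -> R) (v : R -> R) (c d e : R) :
  e \in `[c, d] ->
  {within `[c, d], continuous v} ->
  (forall n, {within `[c, d], continuous (psi n)}) ->
  (forall n x, x \in `[c, d] -> 0 <= psi n x) ->
  (\int[mu]_(x in `[c, d]) psi n x)%R @[n --> \oo] --> (1 : R) ->
  (forall r, 0 < r -> exists A : set R,
     [/\ measurable A, A `<=` `[c, d],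
         (forall x, x \in `[c, d] -> r <= `|x - e| -> A x) &
         (\int[mu]_(x in A) psi n x)%R @[n --> \oo] --> (0 : R)]) ->
  (\int[mu]_(x in `[c, d]) (v x * psi n x))%R @[n --> \oo] --> v e.
Proof.
move=> ecd cv cpsi psi0 psi1 psiA.
have [M M0 vM] := within_continuous_bounded _ _ _ cv.
apply/cvgrPdist_le => eps eps0.
(* The near part costs 2 eta since the mass is eventually at most 2; the far
   part and the defect of the mass from 1 cost eta each. *)
pose eta := eps / 4; have eta0 : 0 < eta by rewrite divr_gt0.
have [r r0 Hr] : exists2 r, 0 < r & forall x, x \in `[c, d] -> `|x - e| < r ->
    `|v x - v e| <= eta.
  have /subspace_continuousP /(_ e) := cv; move=> /(_ ecd) /cvgrPdist_le/(_ _ eta0).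
  move=> [r /= r0 Hr]; exists r => // x xcd xe.
  by rewrite distrC; apply: Hr => //=; rewrite distrC.
have [A [mA Acd Ar psiA0]] := psiA r r0.
have ipsi n : mu.-integrable `[c, d] (EFin \o psi n).
  exact: within_continuous_integrable.
have mI : measurable (`[c, d] : set R) by exact: measurable_itv.
have ipsiA n : mu.-integrable A (EFin \o psi n).
  by apply: integrableS (ipsi n).
have ivpsi n : mu.-integrable `[c, d] (EFin \o (fun x => v x * psi n x)).
  apply: within_continuous_integrable => x; apply: cvgM; [exact: cv|exact: cpsi].
have key n : `|\int[mu]_(x in `[c, d]) (v x * psi n x)
     - v e * \int[mu]_(x in `[c, d]) psi n x|
   <= eta * \int[mu]_(x in `[c, d]) psi n x + (M + M) * \int[mu]_(x in A) psi n x.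
  have ipA : mu.-integrable `[c, d] (EFin \o (psi n \_ A)).
    rewrite -restrict_EFin; apply/integrable_restrict => //.
    by rewrite setIidr.
  have ivpsi' : mu.-integrable `[c, d] (EFin \o (fun x => v e * psi n x)).
    exact: integrable_scale.
  have iub : mu.-integrable `[c, d]
      (EFin \o (fun x => eta * psi n x + (M + M) * (psi n \_ A) x)).
    by apply: integrable_add => //; exact: integrable_scale.
  rewrite -RintegralZl// -RintegralB//.
  apply: le_trans (@le_normr_Rintegral _ _ _ mu _ _ mI _) _.
    exact: integrable_sub.
  have -> : (\int[mu]_(x in A) psi n x =
      \int[mu]_(x in `[c, d]) (psi n \_ A) x)%R.
    by rewrite -Rintegral_mkcondr setIidr.
  rewrite -!RintegralZl// -RintegralD//; last 2 first.
  - exact: integrable_scale.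
  - exact: integrable_scale.
  apply: le_Rintegral => //.
    apply: integrable_norm.
    exact: integrable_sub.
  move=> x /= xcd; have px := psi0 n x xcd.
  rewrite -mulrBl normrM [X in _ * X]ger0_norm//.
  have [xe|xe] := ltP `|x - e| r.
    rewrite ler_wpDr ?ler_wpM2r ?Hr//.
    rewrite mulr_ge0 ?addr_ge0// patchE; by case: ifP.
  rewrite patchE mem_set; last exact: Ar.
  rewrite -mulrDl ler_wpM2r//.
  apply: le_trans (ler_normB _ _) _.
  by rewrite ler_wpDl ?(ltW eta0)// lerD ?vM.
near=> n.
have p1 : `|1 - \int[mu]_(x in `[c, d]) psi n x| <= Num.min 1 (eta / (M + 1)).
  near: n; move/cvgrPdist_le : psi1; apply.
  by rewrite lt_min ltr01 divr_gt0// ltr_wpDl.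
have p2 : `|0 - \int[mu]_(x in A) psi n x| <= eta / (M + M + 1).
  near: n; move/cvgrPdist_le : psiA0; apply.
  by rewrite divr_gt0// ltr_wpDl// addr_ge0.
have := key n.
set I := (\int[mu]_(x in _) psi n x)%R in p1 *.
set K := (\int[mu]_(x in _) (v x * _))%R.
set L := (\int[mu]_(x in A) _)%R in p2 *.
move=> k1.
have p1a : I <= 2.
  have : `|1 - I| <= 1 by rewrite (le_trans p1)// ge_min lexx.
  rewrite ler_norml => /andP[]; lra.
have p1b : `|v e - v e * I| <= eta.
  rewrite -{1}(mulr1 (v e)) -mulrBr normrM.
  have : `|1 - I| <= eta / (M + 1) by rewrite (le_trans p1)// ge_min lexx orbT.
  rewrite ler_pdivlMr ?ltr_wpDl// => H; apply: le_trans H.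
  rewrite mulrC ler_wpM2l// (le_trans (vM _ ecd))// lerDl//.
have p2b : (M + M) * L <= eta.
  move: p2; rewrite sub0r normrN ler_pdivlMr ?ltr_wpDl ?addr_ge0// => H.
  apply: le_trans H; rewrite mulrC ler_pM ?addr_ge0 ?lerDl//.
    by apply: Rintegral_ge0 => x Ax; apply: psi0; exact: Acd.
  exact: ler_norm.
have p3 : eta * I <= eta * 2 by rewrite ler_pM2l.
rewrite -(subrKA (v e * I)) (le_trans (ler_normD _ _))//.
rewrite [X in _ + X]distrC.
have -> : eps = eta + (eta * 2 + eta) by rewrite /eta; field.
by apply: lerD => //; apply: le_trans k1 _; apply: lerD.
Unshelve. all: by end_near. Qed.
End DiracSequence.

(** * Uniqueness of weak derivatives *)

Section WeakDerivative.
Context {R : realType}.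
Notation mu := (@lebesgue_measure R).
Implicit Types (f g u v w phi : R -> R) (a b : R).

Lemma ae_imply (P Q : R -> Prop) : (forall x, P x -> Q x) ->
  {ae mu, forall x, P x} -> {ae mu, forall x, Q x}.
Proof. by move=> PQ; apply: (@filterS _ _ (ae_filter_ringOfSetsType mu)). Qed.

Lemma ae_imply2 (P Q S : R -> Prop) : (forall x, P x -> Q x -> S x) ->
  {ae mu, forall x, P x} -> {ae mu, forall x, Q x} -> {ae mu, forall x, S x}.
Proof. by move=> PQ; apply: (@filterS2 _ _ (ae_filter_ringOfSetsType mu)). Qed.

Lemma itv_cc_I01 a b : 0 < a -> b < 1 -> (`[a, b] : set R) `<=` I01.
Proof.
move=> a0 b1 x; rewrite /I01/= !in_itv/= => /andP[ax xb].
by rewrite (lt_le_trans a0 ax) (le_lt_trans xb b1).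
Qed.

Lemma measurable_I01 : measurable (@I01 R).
Proof. exact: measurable_itv. Qed.
Hint Resolve measurable_I01 : core.

Lemma locally_integrable_compact D f (K : set R) : locally_integrable D f ->
  compact K -> K `<=` D -> mu.-integrable K (EFin \o f).
Proof.
move=> [mf oD fK] cK KD; apply/integrableP; split; last exact: fK.
apply/measurable_EFinP; apply: measurable_funS mf => //.
exact: open_measurable.
Qed.

Lemma locally_integrable_itv f a b : locally_integrable I01 f ->
  0 < a -> b < 1 -> mu.-integrable `[a, b] (EFin \o f).
Proof.
move=> lf a0 b1; apply: locally_integrable_compact lf _ _.
  exact: segment_compact.
exact: itv_cc_I01.
Qed.

Lemma test_continuous phi : test_function phi -> continuous phi.
Proof. by move=> [dphi _ _]; apply: derivable_continuous => x; exact: (dphi 0%N). Qed.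

(** A function that vanishes on an open set has zero derivative there, so
    differentiation does not enlarge the support. *)
Lemma test_function_derive phi : test_function phi -> test_function (derive1 phi).
Proof.
move=> [dphi cphi sphi].
have sub : closure [set x | derive1 phi x != 0] `<=` closure [set x | phi x != 0].
  rewrite [X in X `<=` _]closureE => x; apply; split; first exact: closed_closure.
  move=> y /= ; apply: contraNP => ny; apply/eqP.
  have : open (~` closure [set x | phi x != 0]) by apply/closed_openC/closed_closure.
  rewrite openE => /(_ _ ny) H.
  rewrite derive1E -(derive_cst (0 : R) y 1); apply: near_eq_derive.
  apply: filterS H => z /= nz; apply/eqP/negP => /negP z0; apply: nz.
  exact: subset_closure.
split.
- by move=> n x; rewrite -derive1Sn; exact: (dphi n.+1).
- by apply: subclosed_compact cphi sub; exact: closed_closure.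
- exact: subset_trans sphi.
Qed.

(** Local integrability suffices: the test function is bounded and lives on a
    compact subset of (0, 1). *)
Lemma integrable_mul_test f phi : locally_integrable I01 f -> test_function phi ->
  mu.-integrable I01 (EFin \o (fun x => f x * phi x)).
Proof.
move=> lf tphi; have [dphi cphi sphi] := tphi.
set K := closure _ in cphi sphi.
have mK : measurable K by apply: closed_measurable; exact: closed_closure.
have [M M0 HM] := within_continuous_bounded _ 0 1
   (continuous_subspaceT (test_continuous _ tphi)).
have fK : mu.-integrable K (EFin \o (fun x => f x * phi x)).
  apply: (integrable_mul_bounded _ _ _ M) => //.
  - exact: locally_integrable_compact lf _ _.
  - apply: measurable_funTS; apply: continuous_measurable_fun.
    exact: test_continuous.
  - move=> x Kx; apply: HM; have := sphi x Kx.
    by rewrite /I01/= !in_itv/= => /andP[? ?]; rewrite !ltW.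
apply: (@eq_integrable _ _ _ mu I01 measurable_I01
  ((EFin \o (fun x => f x * phi x)) \_ K)).
  move=> x _; rewrite patchE; case: ifPn => // xK /=.
  suff -> : phi x = 0 by rewrite mulr0.
  apply/eqP/negP => /negP x0; move/negP: xK; apply; rewrite inE.
  exact: subset_closure.
apply/(integrable_restrict mu) => //.
by rewrite (setIidr sphi).
Qed.

Lemma bumpfun_continuous a b n : continuous (bumpfun a b n).
Proof.
apply: derivable_continuous => x.
exact: (@ex_derive _ _ _ _ _ _ _ (is_derive_bumpfun a b n x)).
Qed.

(** Dominated convergence, with dominating function |f|. *)
Lemma bumpfun_Rintegral_cvg f a b : a < b -> mu.-integrable `[a, b] (EFin \o f) ->
  (\int[mu]_(x in `]a, b[) (f x * bumpfun a b n x))%R @[n --> \oo] -->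
  (\int[mu]_(x in `]a, b[) f x)%R.
Proof.
move=> ab fi.
have mI : measurable (`]a, b[ : set R) by exact: measurable_itv.
have fi' : mu.-integrable `]a, b[ (EFin \o f).
  by apply: integrableS fi => //; exact: subset_itv_oo_cc.
have mf : measurable_fun `]a, b[ f by apply/measurable_EFinP; case/integrableP: fi'.
have mb n : measurable_fun `]a, b[ (bumpfun a b n).
  apply: measurable_funTS; apply: continuous_measurable_fun.
  exact: bumpfun_continuous.
have [] := @dominated_convergence _ _ _ mu `]a, b[%classic mI
   (fun n => EFin \o (fun x => f x * bumpfun a b n x)) (EFin \o f) (abse \o (EFin \o f)).
- move=> n; apply/measurable_EFinP. apply: measurable_funM. exact: mf. exact: mb.
- exact/measurable_EFinP.
- apply: aeW => x /= xab; apply: cvg_EFin; first exact: nearW.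
  rewrite -[X in _ --> X]mulr1; apply: cvgMl_tmp.
  exact: bumpfun_cvg.
- exact: integrable_abse.
- apply: aeW => x n xab /=; rewrite lee_fin normrM ler_piMr//.
  by rewrite ger0_norm ?bumpfun_ge0 ?bumpfun_le1.
move=> _ _ H; apply: fine_cvg; rewrite fineK; first exact: H.
exact: integrable_fin_num.
Qed.

Lemma test_orthogonal_itv f a b : 0 < a -> a < b -> b < 1 ->
  locally_integrable I01 f ->
  (forall phi, test_function phi -> (\int[mu]_(x in I01) (f x * phi x))%R = 0) ->
  (\int[mu]_(x in `]a, b[) f x)%R = 0.
Proof.
move=> a0 ab b1 lf H.
have := bumpfun_Rintegral_cvg f a b ab (locally_integrable_itv _ _ _ lf a0 b1).
have -> : (fun n => \int[mu]_(x in `]a, b[) (f x * bumpfun a b n x))%R = (fun n => 0).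
  apply/funext => n; rewrite -(Rintegral_support I01 `]a, b[).
  - by apply: H; exact: bumpfun_test.
  - move=> x xab; apply: (itv_cc_I01 a b) => //.
    exact: subset_itv_oo_cc.
  - move=> x _ /negP xab; rewrite bumpfun_out ?mulr0//.
by move=> /cvg_unique; apply => //; exact: cvg_cst.
Qed.

(** Fundamental lemma of the calculus of variations.  Testing against the bumps
    shows that [f] has zero integral over every interval inside (0, 1).  The
    primitive of the restriction of [f] to [a, b] is therefore zero, and the
    restriction, which is its derivative almost everywhere by Lebesgue
    differentiation, is zero almost everywhere.  Compact intervals exhausting
    (0, 1) give the claim. *)
Lemma test_orthogonal_ae0 f : locally_integrable I01 f ->
  (forall phi, test_function phi -> (\int[mu]_(x in I01) (f x * phi x))%R = 0) ->
  ae_eq mu I01 f (cst 0).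
Proof.
move=> lf H.
have loc a b : 0 < a -> a < b -> b < 1 ->
    {ae mu, forall x, `[a, b]%classic x -> f x = 0}.
  move=> a0 ab b1; pose g := f \_ `[a, b].
  have fi := locally_integrable_itv _ _ _ lf a0 b1.
  have mI : measurable (`[a, b] : set R) by exact: measurable_itv.
  have gi : mu.-integrable setT (EFin \o g).
    by rewrite -restrict_EFin; apply/(integrable_restrict mu) => //; rewrite setTI.
  have gl : locally_integrable setT g by exact: integrable_locally_restrict.
  have := FTC1Ny (f := g) _ gl; rewrite /=.
  have -> : (fun x => \int[mu]_(t in `]-oo, x]) g t)%R = cst 0.
    apply/funext => x /=.
    have [xa|ax] := leP x a.
      rewrite (Rintegral_support _ `[x, x]).
      - by rewrite set_itv1 Rintegral_set1.
      - by move=> y /=; rewrite !in_itv/= => /andP[_ ->].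
      - move=> y /=; rewrite !in_itv/= => yx /negP; rewrite yx andbT -ltNge => {}yx.
        rewrite /g patchE memNset//= in_itv/= leNgt (lt_le_trans yx xa)//.
    have am : a < Num.min x b by rewrite lt_min ax.
    have mb : Num.min x b <= b by rewrite ge_min lexx orbT.
    have fim : mu.-integrable `[a, Num.min x b] (EFin \o f).
      by apply: integrableS fi => //; apply: subset_itvl; rewrite bnd_simp.
    rewrite /g -Rintegral_mkcondr.
    rewrite [X in Rintegral _ X _](_ : _ = `[a, Num.min x b]%classic); last first.
      apply/seteqP; split => y /=; rewrite !in_itv/= le_min.
        by move=> [-> /andP[-> ->]].
      by move=> /andP[-> /andP[-> ->]].
    rewrite -Rintegral_itv_bndo_bndc; last first.
      by apply: integrableS fim => //; apply: subset_itvl; rewrite bnd_simp.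
    rewrite -Rintegral_itv_obnd_cbnd; last first.
      by apply: integrableS fim => //; apply: subset_itv; rewrite bnd_simp.
    by apply: test_orthogonal_itv => //; exact: le_lt_trans mb b1.
  move=> K; have {K} := K (fun y => @integrableS _ _ _ mu _ _ _ measurableT
    (measurable_itv `]-oo, y]) (@subsetT _ _) gi).
  apply: ae_imply => x [_ ] + xab.
  by rewrite derive1_cst /g patchE mem_set.
(* The offset 3 keeps a n < 1 - a n already for n = 0. *)
pose a (n : nat) : R := n.+3%:R^-1.
have : {ae mu, forall x, forall n, `[a n, 1 - a n]%classic x -> f x = 0}.
  apply: ae_foralln => n; apply: loc; rewrite /a ?invr_gt0//.
  have : (n.+3%:R : R)^-1 <= 3^-1 by rewrite lef_pV2 ?posrE// ler_nat.
  move: (n.+3%:R^-1 : R) => z; lra.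
apply: ae_imply => x Hx; rewrite /I01/= in_itv/= => /andP[x0 x1].
pose m := Num.min x (1 - x); have m0 : 0 < m by rewrite lt_min x0 subr_gt0.
have am : a (Num.bound m^-1) <= m.
  rewrite /a -[leRHS]invrK lef_pV2 ?posrE ?invr_gt0//.
  apply: le_trans (ltW (archi_boundP _)) _; first by rewrite invr_ge0 ltW.
  by rewrite ler_nat -addn3 leq_addr.
apply: (Hx (Num.bound m^-1)); rewrite /= in_itv/=.
apply/andP; split; first by rewrite (le_trans am)// ge_min lexx.
by rewrite lerBrDr addrC -lerBrDr (le_trans am)// ge_min lexx orbT.
Qed.

End WeakDerivative.

(** * The fundamental theorem for weak derivatives *)

Section WeakDerivativeFTC.
Context {R : realType}.
Notation mu := (@lebesgue_measure R).
Implicit Types (f g u v w phi : R -> R) (a b : R).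
Let mI01 : measurable (@I01 R : set (measurableTypeR R)) := measurable_I01.
Hint Resolve measurable_I01 mI01 : core.

Lemma weak_derivativeB u1 u2 w1 w2 : is_weak_derivative u1 w1 ->
  is_weak_derivative u2 w2 -> is_weak_derivative (u1 \- u2) (w1 \- w2).
Proof.
move=> [lu1 lw1 H1] [lu2 lw2 H2]; split; [exact: locally_integrableB..|].
move=> phi tphi; have tdphi := test_function_derive _ tphi.
under eq_Rintegral do rewrite mulrBl.
under [X in _ = - X]eq_Rintegral do rewrite mulrBl.
rewrite RintegralB ?RintegralB//; try exact: integrable_mul_test.
by rewrite H1// H2// opprB addrC opprK.
Qed.

Lemma weak_derivative_unique u w1 w2 : is_weak_derivative u w1 ->
  is_weak_derivative u w2 -> ae_eq mu I01 w1 w2.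
Proof.
move=> [lu lw1 H1] [_ lw2 H2].
have : ae_eq mu I01 (w1 \- w2) (cst 0).
  apply: test_orthogonal_ae0; first exact: locally_integrableB.
  move=> phi tphi; under eq_Rintegral do rewrite mulrBl.
  rewrite RintegralB//; try exact: integrable_mul_test.
  by apply/eqP; rewrite subr_eq0 -eqr_opp -H1// -H2.
by apply: ae_imply => x /[swap] xI /(_ xI)/= /eqP; rewrite subr_eq0 => /eqP.
Qed.

Lemma wderivP u w : is_weak_derivative u w -> is_weak_derivative u (wderiv u).
Proof. by move=> uw; apply: (@getPex _ [set w | is_weak_derivative u w]); exists w. Qed.

(** This removes the arbitrary choice in [wderiv]: inside integrals it can be
    replaced by any explicit weak derivative. *)
Lemma wderiv_ae u w : is_weak_derivative u w -> ae_eq mu I01 (wderiv u) w.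
Proof. by move=> uw; apply: weak_derivative_unique (uw); exact: wderivP uw. Qed.

Lemma Rintegral_itv_split f a b c : a <= c -> c <= b ->
  mu.-integrable `[a, b] (EFin \o f) ->
  (\int[mu]_(x in `[a, b]) f x = \int[mu]_(x in `[a, c]) f x +
                                 \int[mu]_(x in `[c, b]) f x)%R.
Proof.
move=> ac cb fi; have := @Rintegral_itvB _ f (BLeft a) (BRight b) c fi.
rewrite !bnd_simp => /(_ ac cb) H.
apply/eqP; rewrite addrC -subr_eq H; apply/eqP.
apply: Rintegral_itv_obnd_cbnd; apply: integrableS fi => //.
by apply: subset_itvr; rewrite bnd_simp.
Qed.

Lemma Rintegral_itv_oo f a b : mu.-integrable `[a, b] (EFin \o f) ->
  (\int[mu]_(x in `]a, b[) f x = \int[mu]_(x in `[a, b]) f x)%R.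
Proof.
move=> fi; rewrite Rintegral_itv_bndo_bndc; last first.
  by apply: integrableS fi => //; apply: subset_itv; rewrite bnd_simp.
rewrite Rintegral_itv_obnd_cbnd//.
by apply: integrableS fi => //; apply: subset_itv; rewrite bnd_simp.
Qed.

Lemma dbumpfun_continuous a b n : a < b -> 0 < a -> b < 1 -> continuous (dbumpfun a b n).
Proof.
move=> ab a0 b1; rewrite -derive1_bumpfun; apply: test_continuous.
by apply: test_function_derive; exact: bumpfun_test.
Qed.

(** On the left half of [a, b] the bump is increasing, so its derivative is
    nonnegative, with integral over [y, m] equal to the difference of the
    bump's values.  The bump tends to 1 at every y > a but is 0 at a: the mass
    tends to 1 and concentrates at a. *)
Lemma dbumpfun_dirac_left v a b : 0 < a -> a < b -> b < 1 ->
  {within `[a, b], continuous v} ->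
  (\int[mu]_(x in `[a, (a + b) / 2]) (v x * dbumpfun a b n x))%R @[n --> \oo] --> v a.
Proof.
move=> a0 ab b1 cv; set m := (a + b) / 2.
have am : a < m by rewrite /m; lra.
have mb : m < b by rewrite /m; lra.
have cd n : continuous (dbumpfun a b n) by exact: dbumpfun_continuous.
have ftc n x y : x <= y ->
    (\int[mu]_(t in `[x, y]) dbumpfun a b n t)%R = bumpfun a b n y - bumpfun a b n x.
  by move=> xy; apply: Rintegral_derive => // t; exact: is_derive_bumpfun.
have c1 y : y \in `]a, m] -> bumpfun a b n y @[n --> \oo] --> (1 : R).
  move=> ym; apply: bumpfun_cvg; move: ym; rewrite !in_itv/= => /andP[-> ym].
  exact: le_lt_trans ym mb.
apply: dirac_sequence_cvg.
- by rewrite in_itv/= lexx ltW.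
- apply: continuous_subspaceW cv; apply: subset_itvl; rewrite bnd_simp; exact: ltW.
- by move=> n; apply: continuous_subspaceT; exact: cd.
- move=> n x; rewrite in_itv/= => /andP[ax xm]; rewrite /dbumpfun mulr_ge0//.
    rewrite /expinv; case: ifP => // _.
    by rewrite hornerXn mulr_ge0 ?expR_ge0 ?sqr_ge0.
  by rewrite mulr_ge0//; move: xm; rewrite /m; lra.
- under eq_fun do rewrite ftc ?(ltW am)// [X in _ - X]bumpfun_out ?subr0 ?in_itv/= ?ltxx//.
  by apply: c1; rewrite in_itv/= am lexx.
- move=> r r0; pose y := Num.min (a + r) m; exists `[y, m]%classic; split.
  + exact: measurable_itv.
  + by apply: subset_itvr; rewrite bnd_simp le_min (ltW am) lerDl (ltW r0).
  + move=> x; rewrite /= !in_itv/= => /andP[ax xm]; rewrite ger0_norm ?subr_ge0//.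
    by move=> rx; rewrite xm andbT ge_min; apply/orP; left; lra.
  + have ym : y <= m by rewrite ge_min lexx orbT.
    rewrite (_ : (fun n => _) = (fun n => bumpfun a b n m - bumpfun a b n y)); last first.
      by apply/funext => n; exact: ftc.
    rewrite -[X in _ --> X](subrr (1 : R)); apply: cvgB; apply: c1.
      by rewrite in_itv/= am lexx.
    by rewrite in_itv/= ym andbT lt_min am ltrDl r0.
Qed.

(** The same concentration at b, where the bump decreases from values near 1
    to 0; hence the sign. *)
Lemma dbumpfun_dirac_right v a b : 0 < a -> a < b -> b < 1 ->
  {within `[a, b], continuous v} ->
  (\int[mu]_(x in `[(a + b) / 2, b]) (v x * - dbumpfun a b n x))%R @[n --> \oo] --> v b.
Proof.
move=> a0 ab b1 cv; set m := (a + b) / 2.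
have am : a < m by rewrite /m; lra.
have mb : m < b by rewrite /m; lra.
have cd n : continuous (dbumpfun a b n) by exact: dbumpfun_continuous.
have ftc n x y : x <= y ->
    (\int[mu]_(t in `[x, y]) - dbumpfun a b n t)%R = bumpfun a b n x - bumpfun a b n y.
  move=> xy; have dN (t : R) : is_derive t 1 (- bumpfun a b n) (- dbumpfun a b n t).
    by apply: is_deriveN; exact: is_derive_bumpfun.
  rewrite (Rintegral_derive (- bumpfun a b n) _ _ _ xy dN); last first.
    by move=> t; apply: cvgN; exact: cd.
  by rewrite !fctE opprK addrC.
have c1 y : y \in `[m, b[ -> bumpfun a b n y @[n --> \oo] --> (1 : R).
  move=> ym; apply: bumpfun_cvg; move: ym; rewrite !in_itv/= => /andP[ym ->].
  by rewrite andbT (lt_le_trans am ym).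
apply: (dirac_sequence_cvg (fun n x => - dbumpfun a b n x)).
- by rewrite in_itv/= lexx ltW.
- apply: continuous_subspaceW cv; apply: subset_itvr; rewrite bnd_simp; exact: ltW.
- by move=> n; apply: continuous_subspaceT => x; apply: cvgN; exact: cd.
- move=> n x; rewrite in_itv/= => /andP[mx xb]; rewrite /dbumpfun -mulrN mulr_ge0//.
    rewrite /expinv; case: ifP => // _.
    by rewrite hornerXn mulr_ge0 ?expR_ge0 ?sqr_ge0.
  by rewrite -mulrN mulr_ge0//; move: mx; rewrite /m; lra.
- under eq_fun do rewrite ftc ?(ltW mb)// [X in _ - X]bumpfun_out ?subr0 ?in_itv/= ?ltxx ?andbF//.
  by apply: c1; rewrite in_itv/= mb lexx.
- move=> r r0; pose y := Num.max (b - r) m; exists `[m, y]%classic; split.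
  + exact: measurable_itv.
  + by apply: subset_itvl; rewrite bnd_simp ge_max (ltW mb) gerBl (ltW r0).
  + move=> x; rewrite /= !in_itv/= => /andP[mx xb]; rewrite ler0_norm ?subr_le0//.
    by move=> rx; rewrite mx/= le_max; apply/orP; left; lra.
  + have my : m <= y by rewrite le_max lexx orbT.
    rewrite (_ : (fun n => _) = (fun n => bumpfun a b n m - bumpfun a b n y)); last first.
      by apply/funext => n; exact: ftc.
    rewrite -[X in _ --> X](subrr (1 : R)); apply: cvgB; apply: c1.
      by rewrite in_itv/= mb lexx.
    by rewrite in_itv/= my/= gt_max mb andbT ltrBlDr ltrDl.
Qed.

(** Use the bumps in the definition of the weak derivative: tested against [w]
    they converge to the integral of [w] over (a, b), and their derivatives
    tested against [v] converge to v a - v b. *)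
Lemma weak_derivative_FTC_oo v w a b : {within `[0, 1], continuous v} ->
  is_weak_derivative v w -> 0 < a -> a < b -> b < 1 ->
  v b - v a = (\int[mu]_(x in `[a, b]) w x)%R.
Proof.
move=> cv [_ lw H] a0 ab b1; set m := (a + b) / 2.
have am : a < m by rewrite /m; lra.
have mb : m < b by rewrite /m; lra.
have cvab : {within `[a, b], continuous v}.
  by apply: continuous_subspaceW cv; apply: subset_itv; rewrite bnd_simp ltW.
have cd n : continuous (dbumpfun a b n) by exact: dbumpfun_continuous.
have fw := locally_integrable_itv _ _ _ lw a0 b1.
have sub : `]a, b[ `<=` (@I01 R).
  apply: subset_trans (itv_cc_I01 _ _ a0 b1); exact: subset_itv_oo_cc.
have H1 := bumpfun_Rintegral_cvg w a b ab fw.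
have H2 : (fun n => \int[mu]_(x in `[m, b]) (v x * - dbumpfun a b n x) -
    \int[mu]_(x in `[a, m]) (v x * dbumpfun a b n x))%R @ \oo --> v b - v a.
  by apply: cvgB; [exact: dbumpfun_dirac_right|exact: dbumpfun_dirac_left].
rewrite (Rintegral_itv_oo _ _ _ fw) in H1.
move/cvg_unique : H2; apply => //.
apply: cvg_trans H1; apply: near_eq_cvg; near=> n.
have := H _ (bumpfun_test a b ab n a0 b1); rewrite derive1_bumpfun.
have ivd : mu.-integrable `[a, b] (EFin \o (fun x => v x * dbumpfun a b n x)).
  apply: within_continuous_integrable => x; apply: cvgM; first exact: cvab.
  by apply: continuous_subspaceT; exact: cd.
rewrite (Rintegral_support I01 `[a, b]); last 2 first.
- exact: itv_cc_I01.
- move=> x _ /= /negP xab; rewrite dbumpfun_out ?mulr0//.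
  by apply: contra xab; rewrite !in_itv/= => /andP[? ?]; rewrite !ltW.
rewrite (Rintegral_itv_split _ a b m) ?ltW//.
rewrite (Rintegral_support I01 `]a, b[ (fun x => w x * _))//; last first.
  by move=> x _ /= /negP xab; rewrite bumpfun_out ?mulr0.
move=> E; rewrite -[LHS]opprK -E opprD addrC; congr (_ - _).
rewrite -mulN1r -RintegralZl//; last first.
  by apply: integrableS ivd => //; apply: subset_itvr; rewrite bnd_simp ltW.
by apply: eq_Rintegral => x _; rewrite mulN1r mulrN.
Unshelve. all: by end_near. Qed.

(** The function v - int_0^x w is constant on (0, 1) and continuous on [0, 1],
    hence constant on [0, 1]. *)
Lemma weak_derivative_FTC v w : {within `[0, 1], continuous v} ->
  is_weak_derivative v w -> mu.-integrable `[0, 1] (EFin \o w) ->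
  forall x, x \in `[0, 1] -> v x - v 0 = (\int[mu]_(t in `[0, x]) w t)%R.
Proof.
move=> cv vw iw.
pose V x := v x - (\int[mu]_(t in `[0, x]) w t)%R.
have cV : {within `[0, 1], continuous V}.
  move=> x; apply: cvgB; first exact: cv.
  exact: (parameterized_integral_continuous ler01 iw).
have V0 : V 0 = v 0 by rewrite /V set_itv1 Rintegral_set1 subr0.
have Vab a b : 0 < a -> a < b -> b < 1 -> V a = V b.
  move=> a0 ab b1; have := weak_derivative_FTC_oo _ _ _ _ cv vw a0 ab b1.
  have : mu.-integrable `[0, b] (EFin \o w).
    by apply: integrableS iw => //; apply: subset_itvl; rewrite bnd_simp ltW.
  move=> /(Rintegral_itv_split _ _ _ _ (ltW a0) (ltW ab)) => E1 E2.
  by rewrite /V E1 -E2; ring.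
have VE x : 0 < x -> x < 1 -> V x = V (2^-1).
  move=> x0 x1; have [xh|xh|->//] := ltgtP x (2^-1).
    by apply: Vab => //; lra.
  by apply/esym; apply: Vab => //; lra.
have /(continuous_within_itvP _ ltr01)[_ cV0 cV1] := cV.
have E0 : V 0 = V (2^-1).
  move/cvg_unique : cV0; apply => //.
  apply: cvg_near_cst; near=> x; apply: VE => //.
have E1 : V 1 = V (2^-1).
  move/cvg_unique : cV1; apply => //.
  apply: cvg_near_cst; near=> x; apply: VE => //.
move=> x; rewrite in_itv/= => /andP[]; rewrite le_eqVlt => /predU1P[<- _|x0].
  by rewrite set_itv1 Rintegral_set1 subrr.
rewrite le_eqVlt => x1; have : V x = v 0.
  by case/predU1P : x1 => [->|x1]; rewrite -V0 E0 ?E1 ?VE.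
by rewrite /V => <-; ring.
Unshelve. all: by end_near. Qed.

End WeakDerivativeFTC.

(** * Finite element functions *)

Section FiniteElements.
Context {R : realType}.
Notation mu := (@lebesgue_measure R).
Implicit Types (f g u v w phi : R -> R) (a b c d : R) (N k : nat).

Definition node N k : R := k%:R * mesh N.

Lemma nodeS N k : node N k.+1 = node N k + mesh N.
Proof. by rewrite /node -addn1 natrD mulrDl mul1r. Qed.

Lemma mesh_gt0 N : (0 < N)%N -> 0 < mesh N :> R.
Proof. by move=> N0; rewrite /mesh invr_gt0 ltr0n. Qed.

Lemma mesh_le1 N : mesh N <= 1 :> R.
Proof.
rewrite /mesh; case: N => [|N]; first by rewrite invr0.
by rewrite invf_le1// ler1n.
Qed.

Lemma node0 N : node N 0 = 0. Proof. by rewrite /node mul0r. Qed.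

Lemma nodeN N : (0 < N)%N -> node N N = 1.
Proof. by move=> N0; rewrite /node /mesh divff// pnatr_eq0 -lt0n. Qed.

Lemma node_le N j k : (j <= k)%N -> node N j <= node N k.
Proof.
by move=> jk; rewrite /node ler_wpM2r ?ler_nat// /mesh invr_ge0.
Qed.

Lemma node_lt N k : (0 < N)%N -> node N k < node N k.+1.
Proof. by move=> N0; rewrite nodeS ltrDl mesh_gt0. Qed.

Lemma node_ge0 N k : 0 <= node N k.
Proof. by rewrite -(node0 N) node_le. Qed.

Lemma node_le1 N k : (k <= N)%N -> node N k <= 1.
Proof.
case: N => [|N] kN; first by rewrite /node /mesh invr0 mulr0.
by rewrite -(nodeN N.+1)// node_le.
Qed.

Definition elt N k : set R := `]node N k, node N k.+1[.

(** As a sum of indicators the step function is visibly measurable and bounded;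
    it takes the value 0 at the nodes, a null set. *)
Definition stepfun N (s : nat -> R) (x : R) : R :=
  \sum_(k < N) s k * \1_(elt N k) x.

Lemma elt_inj N j k x : elt N j x -> elt N k x -> j = k.
Proof.
rewrite /elt/= !in_itv/= => /andP[j1 j2] /andP[k1 k2].
have [jk|kj|//] := ltngtP j k.
  by have := lt_le_trans j2 (le_trans (node_le N _ _ jk) (ltW k1)); rewrite ltxx.
by have := lt_le_trans k2 (le_trans (node_le N _ _ kj) (ltW j1)); rewrite ltxx.
Qed.

Lemma stepfun_elt N s k x : (k < N)%N -> elt N k x -> stepfun N s x = s k.
Proof.
move=> kN xk; rewrite /stepfun (bigD1 (Ordinal kN))//= indicE mem_set// mulr1.
rewrite big1 ?addr0// => j jk; rewrite indicE memNset ?mulr0// => xj.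
by move/eqP: jk; apply; apply/val_inj => /=; exact: elt_inj xj xk.
Qed.

Lemma measurable_stepfun D N s : measurable D -> measurable_fun D (stepfun N s).
Proof.
move=> mD; apply: measurable_sum => k; apply: measurable_funM => //.
by apply: measurable_funTS; apply: measurable_indic; exact: measurable_itv.
Qed.

Lemma stepfun_bounded N s : exists M, forall x, `|stepfun N s x| <= M.
Proof.
exists (\sum_(k < N) `|s k|) => x; apply: le_trans (ler_norm_sum _ _ _) _.
apply: ler_sum => k _; rewrite normrM ler_piMr// indicE.
by case: (_ \in _); rewrite ?normr1 ?normr0.
Qed.

Lemma stepfun_integrable N s a b : mu.-integrable `[a, b] (EFin \o stepfun N s).
Proof.
have [M HM] := stepfun_bounded N s.
have := integrable_mul_bounded `[a, b] (cst 1) (stepfun N s) M.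
rewrite (_ : (EFin \o (fun x => cst 1 x * stepfun N s x)) = EFin \o stepfun N s).
  apply => //; last exact: measurable_stepfun.
  by apply: within_continuous_integrable; apply: continuous_subspaceT => x; exact: cvg_cst.
by apply/funext => x /=; rewrite mul1r.
Qed.

Lemma within_continuous_affine_ends v a b (s t : R) : a < b ->
  {within `[a, b], continuous v} ->
  (forall x, x \in `]a, b[ -> v x = s * x + t) ->
  forall x, x \in `[a, b] -> v x = s * x + t.
Proof.
move=> ab /(continuous_within_itvP _ ab)[_ ca cb] H.
have aff : continuous (fun x : R => s * x + t).
  by move=> x; apply: cvgD; [apply: cvgMl_tmp; exact: cvg_id|exact: cvg_cst].
have va : v a = s * a + t.
  move/cvg_unique: ca; apply => //.
  have := cvg_at_right_filter (aff a); apply: cvg_trans; apply: near_eq_cvg.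
  by near=> x; rewrite H// in_itv/=; apply/andP; split.
have vb : v b = s * b + t.
  move/cvg_unique: cb; apply => //.
  have := cvg_at_left_filter (aff b); apply: cvg_trans; apply: near_eq_cvg.
  by near=> x; rewrite H// in_itv/=; apply/andP; split.
move=> x; rewrite in_itv/= !le_eqVlt => /andP[/predU1P[<-//|ax] /predU1P[->//|xb]].
by apply: H; rewrite in_itv/= ax.
Unshelve. all: by end_near. Qed.

Lemma test_out phi x : test_function phi -> ~ I01 x -> phi x = 0.
Proof.
move=> [_ _ sphi] x01; apply/eqP/negP => /negP x0; apply/x01/sphi.
exact: subset_closure.
Qed.

Lemma affine_integration_by_parts v g phi a b (s t : R) : a <= b -> test_function phi ->
  (forall x, x \in `[a, b] -> v x = s * x + t) ->
  (forall x, x \in `]a, b[ -> g x = s) ->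
  mu.-integrable `[a, b] (EFin \o (fun x => g x * phi x)) ->
  (\int[mu]_(x in `[a, b]) (v x * derive1 phi x))%R =
  v b * phi b - v a * phi a - (\int[mu]_(x in `[a, b]) (g x * phi x))%R.
Proof.
move=> ab tphi vE gE ig.
have cphi := test_continuous _ tphi.
have cphi' := test_continuous _ (test_function_derive _ tphi).
have dphi (x : R) : is_derive x 1 phi (derive1 phi x).
  by have [/(_ 0%N x) dp _ _] := tphi; rewrite derive1E; exact: derivableP.
have caff : continuous (fun x : R => s * x + t).
  by move=> x; apply: cvgD; [apply: cvgMl_tmp; exact: cvg_id|exact: cvg_cst].
have c1 : continuous (fun x => (s * x + t) * derive1 phi x).
  by move=> x; apply: cvgM; [exact: caff|exact: cphi'].
have c2 : continuous (fun x => s * phi x).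
  by move=> x; apply: cvgMl_tmp; exact: cphi.
have i1 : mu.-integrable `[a, b] (EFin \o (fun x => (s * x + t) * derive1 phi x)).
  by apply: within_continuous_integrable; exact: continuous_subspaceT.
have i2 : mu.-integrable `[a, b] (EFin \o (fun x => s * phi x)).
  by apply: within_continuous_integrable; exact: continuous_subspaceT.
have -> : (\int[mu]_(x in `[a, b]) (g x * phi x))%R =
          (\int[mu]_(x in `[a, b]) (s * phi x))%R.
  rewrite -(Rintegral_itv_oo _ _ _ ig) -(Rintegral_itv_oo _ _ _ i2).
  by apply: eq_Rintegral => x; rewrite inE/= => xab; rewrite gE.
have -> : (\int[mu]_(x in `[a, b]) (v x * derive1 phi x))%R =
          (\int[mu]_(x in `[a, b]) ((s * x + t) * derive1 phi x))%R.
  by apply: eq_Rintegral => x; rewrite inE/= => xab; rewrite vE.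
apply/eqP; rewrite eq_sym subr_eq -RintegralD//; apply/eqP.
rewrite !vE ?in_itv/= ?lexx ?ab//.
pose F := (fun x : R => s * x + t) * phi.
have dF (x : R) : is_derive x 1 F ((s * x + t) * derive1 phi x + s * phi x).
  have daff : is_derive x 1 (fun x : R => s * x + t) s.
    have -> : (fun x : R => s * x + t) = horner (s *: 'X + t%:P).
      by apply/funext => y; rewrite !hornerE.
    apply: is_derive_eq (is_derive_poly _ x) _.
    by rewrite derivD derivZ derivX derivC !hornerE.
  apply: (is_derive_eq (is_deriveM daff (dphi x))).
  rewrite /GRing.scale/= mulrC; congr (_ + _); exact: mulrC.
have cdF : continuous (fun x => (s * x + t) * derive1 phi x + s * phi x).
  by move=> x; apply: cvgD; [exact: c1|exact: c2].
by rewrite (Rintegral_derive F _ _ _ ab dF cdF).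
Qed.

(** Integrate by parts on each element.  By continuity of [v] the boundary terms
    telescope, and what is left vanishes because [phi] is 0 at 0 and 1. *)
Lemma fe_weak_derivative N v s t : (0 < N)%N ->
  {within `[(0 : R), 1], continuous v} ->
  (forall k, (k < N)%N -> {in `]node N k, node N k.+1[, forall x, v x = s k * x + t k}) ->
  is_weak_derivative v (stepfun N s).
Proof.
move=> N0 cv vE.
have oI : open (@I01 R) by exact: itv_open.
have vi := within_continuous_integrable _ _ _ cv.
have subI : (@I01 R) `<=` `[0, 1] by exact: subset_itv_oo_cc.
have mI : measurable (@I01 R) by exact: measurable_I01.
split.
- apply: open_integrable_locally => //; apply: integrableS vi => //.
- apply: open_integrable_locally => //; apply: integrableS (stepfun_integrable N s 0 1) => //.
move=> phi tphi; have tphi' := test_function_derive _ tphi.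
have cphi := test_continuous _ tphi.
have cphi' := test_continuous _ tphi'.
have [M _ HM] := within_continuous_bounded _ 0 1 (continuous_subspaceT cphi).
have ivp : mu.-integrable `[0, 1] (EFin \o (fun x => v x * derive1 phi x)).
  apply: within_continuous_integrable => x; apply: cvgM; first exact: cv.
  by apply: continuous_subspaceT; exact: cphi'.
have igp : mu.-integrable `[0, 1] (EFin \o (fun x => stepfun N s x * phi x)).
  apply: (integrable_mul_bounded _ _ _ M) => //.
  - exact: stepfun_integrable.
  - by apply: measurable_funTS; exact: continuous_measurable_fun.
have claim m : (m <= N)%N ->
    (\int[mu]_(x in `[0%R, node N m]) (v x * derive1 phi x))%R =
    v (node N m) * phi (node N m) - v 0 * phi 0 -
    (\int[mu]_(x in `[0%R, node N m]) (stepfun N s x * phi x))%R.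
  elim: m => [_|m IH mN].
    by rewrite node0 set_itv1 !Rintegral_set1; ring.
  have mM : node N m <= node N m.+1 by exact: node_le.
  have sub c d : 0 <= c -> d <= 1 -> (`[c, d] : set R) `<=` `[0, 1].
    by move=> c0 d1; apply: subset_itv; rewrite bnd_simp.
  have n1 := node_le1 N _ mN.
  have sub1 := sub _ _ (lexx 0) n1; have sub2 := sub _ _ (node_ge0 N m) n1.
  have inS f c d : (`[c, d] : set R) `<=` `[0, 1] ->
      mu.-integrable `[0, 1] (EFin \o f) -> mu.-integrable `[c, d] (EFin \o f).
    by move=> cd fi; apply: integrableS fi.
  rewrite (Rintegral_itv_split _ _ _ (node N m)) ?node_ge0//; last exact: inS.
  rewrite [in RHS](Rintegral_itv_split _ _ _ (node N m)) ?node_ge0//; last exact: inS.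
  rewrite IH ?(ltnW mN)//.
  rewrite (affine_integration_by_parts _ (stepfun N s) _ _ _ (s m) (t m))//.
  - by ring.
  - apply: within_continuous_affine_ends; first exact: node_lt.
      exact: continuous_subspaceW cv.
    by move=> x; apply: vE.
  - by move=> x xm; exact: stepfun_elt.
  - exact: inS.
have := claim N (leqnn _); rewrite nodeN//.
rewrite (test_out _ 1 tphi) ?(test_out _ 0 tphi) /I01/= ?in_itv/= ?ltxx ?andbF//.
rewrite !mulr0 subr0 sub0r => H.
rewrite !(Rintegral_itv_oo _ 0 1)//.
Qed.

Lemma fe_space_weak_derivative N v : (0 < N)%N -> fe_space N v ->
  exists s, is_weak_derivative v (stepfun N s).
Proof.
move=> N0 [cv vE _ _].
have /choice[st Hst] : forall k, exists st : R * R, (k < N)%N ->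
    {in `]k%:R * mesh N, k.+1%:R * mesh N[, forall x, v x = st.1 * x + st.2}.
  move=> k; case: (ltnP k N) => kN; last by exists (0, 0).
  by have [a [b ab]] := vE k kN; exists (a, b).
exists (fun k => (st k).1); apply: (fe_weak_derivative _ _ _ (fun k => (st k).2)) => //.
Qed.

End FiniteElements.

(** * Power inequalities *)

Section Powers.
Context {R : realType}.
Implicit Types (c t p : R).

(** For t > c the second term is t (t/c)^(p-1) >= t.  With [c] chosen
    appropriately this replaces Hoelder's and Jensen's inequalities, at the
    price of a constant factor. *)
Lemma le_add_powR c t p : 0 < c -> 0 <= t -> 1 <= p ->
  t <= c + c `^ (1 - p) * t `^ p.
Proof.
move=> c0 t0 p1; have [tc|ct] := leP t c.
  by rewrite (le_trans tc)// lerDl mulr_ge0// powR_ge0.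
have tpos : 0 < t := lt_trans c0 ct.
have -> : t `^ p = t * t `^ (p - 1).
  rewrite -[X in X * _](@powRr1 _ t) // -powRD ?(gt_eqF tpos) ?implybT//.
  by congr (_ `^ _); ring.
have H : 1 <= c `^ (1 - p) * t `^ (p - 1).
  rewrite -(opprB p) powRN mulrC ler_pdivlMr ?powR_gt0// mul1r.
  by rewrite ge0_ler_powR ?nnegrE ?subr_ge0// ltW.
rewrite mulrCA (le_trans (_ : t <= t * 1)) ?mulr1//.
by rewrite ler_wpDl ?(ltW c0)// -[leLHS]mulr1 ler_pM2l.
Qed.

End Powers.

Section Mean.
Context {R : realType}.
Notation mu := (@lebesgue_measure R).
Implicit Types (f : R -> R) (p h : R).

(** Jensen's inequality for a mean, with the extra factor 2^p: integrate
    [le_add_powR] with [c] half the mean of [f] and absorb [c] on the left. *)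
Lemma mean_powR (D : set R) f p h : 1 <= p -> 0 < h ->
  measurable D -> mu D = h%:E ->
  (forall x, D x -> 0 <= f x) -> mu.-integrable D (EFin \o f) ->
  (((h^-1 * (\int[mu]_(x in D) f x)%R) `^ p)%:E <=
   (2 `^ p * h^-1)%:E * \int[mu]_(x in D) (f x `^ p)%:E)%E.
Proof.
move=> p1 h0 mD muD f0 fi; set I := (\int[mu]_(x in D) f x)%R.
have I0 : 0 <= I by exact: Rintegral_ge0.
have p0 : p != 0 by rewrite gt_eqF// (lt_le_trans ltr01).
have X0 : (0 <= \int[mu]_(x in D) (f x `^ p)%:E)%E.
  by apply: integral_ge0 => x _; rewrite lee_fin powR_ge0.
move: I0; rewrite le_eqVlt => /predU1P[<-|I0].
  by rewrite mulr0 powR0// mule_ge0// lee_fin mulr_ge0 ?powR_ge0// invr_ge0 ltW.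
have IE : (\int[mu]_(x in D) (f x)%:E = I%:E)%E.
  by rewrite /I /Rintegral fineK//; exact: integrable_fin_num.
(* Half the mean of f. *)
pose c := I / (2 * h); have c0 : 0 < c by rewrite divr_gt0// mulr_gt0.
have mf : measurable_fun D f by apply/measurable_EFinP; case/integrableP: fi.
have mfp : measurable_fun D (fun x => (f x `^ p)%:E).
  by apply/measurable_EFinP; exact: measurableT_comp (measurable_powR p) mf.
have : (I%:E <= (c * h)%:E + (c `^ (1 - p))%:E * \int[mu]_(x in D) (f x `^ p)%:E)%E.
  rewrite -IE EFinM -muD -integral_cst// -ge0_integralZl//; last 2 first.
  - by move=> x _; rewrite lee_fin powR_ge0.
  - by rewrite lee_fin powR_ge0.
  rewrite -ge0_integralD//; last 3 first.
  - by move=> x _; rewrite lee_fin ltW.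
  - by move=> x _; rewrite -EFinM lee_fin mulr_ge0 ?powR_ge0.
  - exact: measurable_funeM.
  apply: ge0_le_integral => //.
  - exact/measurable_EFinP.
  - by apply: emeasurable_funD => //; exact: measurable_funeM.
  - by move=> x Dx; rewrite /= -EFinM -EFinD lee_fin le_add_powR// f0.
move: X0; case: (\int[mu]_(x in D) _)%E => [r r0|_ _|//]; last first.
  rewrite gt0_muley ?leey// lte_fin mulr_gt0 ?powR_gt0// invr_gt0//.
rewrite -!EFinM -EFinD !lee_fin => H.
have IcE : I = 2 * (c * h) by rewrite /c; field; rewrite gt_eqF.
have : c * h <= c `^ (1 - p) * r by move: H; rewrite {1}IcE; lra.
have -> : h^-1 * I = 2 * c by rewrite IcE; field; rewrite gt_eqF.
move=> K; rewrite powRM ?(ltW c0)//.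
have -> : 2 `^ p / h * r = 2 `^ p * (r / h) by rewrite mulrAC mulrA.
rewrite ler_pM2l ?powR_gt0// ler_pdivlMr//.
have -> : c `^ p = c * c `^ (p - 1).
  rewrite -[X in X * _](@powRr1 _ c) ?(ltW c0) // -powRD ?(gt_eqF c0) ?implybT//.
  by congr (_ `^ _); ring.
move: K; rewrite -(opprB p) powRN ler_pdivlMl ?powR_gt0//.
by rewrite mulrCA mulrA mulrAC.
Qed.

End Mean.

(** * The cut-off function *)

Section CutOff.
Context {R : realType}.
Implicit Types (h alpha t L : R).

(** The cut-off clips [t] to an interval; in this form its measurability and its
    Lipschitz bound follow from those of minimum and maximum. *)
Lemma chiE h alpha t : chi h alpha t =
  Num.max (- h `^ (- alpha)) (Num.min t (h `^ (- alpha))).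
Proof.
rewrite /chi; have := powR_ge0 h (- alpha); move: (h `^ _) => L L0.
have [t0|t0|t0] := ltgtP t 0.
- rewrite ltr0_sg// ltr0_norm// mulN1r (@min_l _ _ t L); last by lra.
  by rewrite oppr_min opprK maxC.
- rewrite gtr0_sg// gtr0_norm// mul1r max_r// le_min; lra.
- by rewrite t0 sgr0 mul0r min_l// max_r// oppr_le0.
Qed.

Lemma chi_norm_le h alpha t : `|chi h alpha t| <= h `^ (- alpha).
Proof.
rewrite chiE; have := powR_ge0 h (- alpha); move: (h `^ _) => L L0.
by rewrite ler_norml le_max lexx/= ge_max ge_min lexx orbT andbT; lra.
Qed.

Lemma chi_norm_le_id h alpha t : `|chi h alpha t| <= `|t|.
Proof.
rewrite /chi normrM; have [->|t0] := eqVneq t 0; first by rewrite sgr0 normr0 mul0r.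
rewrite normr_sg t0 mul1r ger0_norm ?ge_min ?lexx//.
by rewrite le_min normr_ge0 powR_ge0.
Qed.

Lemma max_lipschitz (c t u : R) : `|Num.max c t - Num.max c u| <= `|t - u|.
Proof.
have [ct|ct] := leP c t; have [cu|cu] := leP c u; rewrite ?subrr ?normr0//.
- by rewrite !ger0_norm; lra.
- by rewrite !ler0_norm; lra.
Qed.

Lemma min_lipschitz (c t u : R) : `|Num.min t c - Num.min u c| <= `|t - u|.
Proof.
have [ct|ct] := leP t c; have [cu|cu] := leP u c; rewrite ?subrr ?normr0//.
- by rewrite !ler0_norm; lra.
- by rewrite !ger0_norm; lra.
Qed.

Lemma chi_lipschitz h alpha t u : `|chi h alpha t - chi h alpha u| <= `|t - u|.
Proof.
by rewrite !chiE; apply: le_trans (max_lipschitz _ _ _) (min_lipschitz _ _ _).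
Qed.

Lemma chi_id h alpha t : `|t| <= h `^ (- alpha) -> chi h alpha t = t.
Proof.
by rewrite chiE ler_norml => /andP[Lt tL]; rewrite min_l// max_r.
Qed.

Lemma measurable_chi h alpha : measurable_fun setT (chi h alpha).
Proof.
rewrite (_ : chi h alpha = (fun t => Num.max (- h `^ (- alpha))
  (Num.min t (h `^ (- alpha))))); last by apply/funext => t; exact: chiE.
apply: measurable_maxr; first exact: measurable_cst.
by apply: measurable_minr; [exact: measurable_id|exact: measurable_cst].
Qed.

End CutOff.

(** * Interpolation by element means *)

Section Interpolation.
Context {R : realType}.
Notation mu := (@lebesgue_measure R).
Variables (N : nat) (w : R -> R).
Hypothesis N0 : (0 < N)%N.
Hypothesis iw : mu.-integrable `[0, 1] (EFin \o w).

Definition eltmean (k : nat) : R := (mesh N)^-1 * (\int[mu]_(x in elt N k) w x)%R.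

Definition meanstep : R -> R := stepfun N eltmean.

(** When [w] is the weak derivative of [v] and [c] is [v 0], this is the nodal
    interpolant of [v]; defining it as a primitive exhibits the interpolation
    error as the primitive of [meanstep - w]. *)
Definition interp (c x : R) : R := c + (\int[mu]_(t in `[0, x]) meanstep t)%R.

Let err x := meanstep x - w x.

Lemma integrable_sub01 f a b : mu.-integrable `[(0 : R), 1] (EFin \o f) ->
  0 <= a -> b <= 1 -> mu.-integrable `[a, b] (EFin \o f).
Proof.
move=> fi a0 b1; apply: integrableS fi => //.
by apply: subset_itv; rewrite bnd_simp.
Qed.

Lemma mu_elt k : mu (elt N k) = (mesh N)%:E.
Proof.
rewrite /elt lebesgue_measure_itv/= lte_fin node_lt// -EFinD; congr EFin.
by rewrite nodeS; ring.
Qed.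

Lemma meanstep_integrable a b : mu.-integrable `[a, b] (EFin \o meanstep).
Proof. exact: stepfun_integrable. Qed.

Lemma err_integrable a b : 0 <= a -> b <= 1 -> mu.-integrable `[a, b] (EFin \o err).
Proof.
by move=> a0 b1; apply: integrable_sub => //;
  [exact: meanstep_integrable|exact: integrable_sub01].
Qed.

Lemma err_elt_int0 k : (k < N)%N ->
  (\int[mu]_(x in `[node N k, node N k.+1]) err x = 0)%R.
Proof.
move=> kN; have n0 := node_ge0 N k : (0 : R) <= _.
have n1 := node_le1 N k.+1 kN : _ <= (1 : R).
rewrite /err RintegralB//; [|exact: meanstep_integrable|exact: integrable_sub01].
rewrite -!Rintegral_itv_oo; [|exact: integrable_sub01|exact: meanstep_integrable].
rewrite (_ : (\int[mu]_(x in `]node N k, node N k.+1[) meanstep x =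
  \int[mu]_(x in elt N k) eltmean k)%R); last first.
  by apply: eq_Rintegral => x /set_mem xk; rewrite /meanstep (stepfun_elt _ _ k).
rewrite Rintegral_cst; last exact: measurable_itv.
rewrite (_ : fine _ = mesh N); last exact: (congr1 fine (mu_elt k)).
rewrite /eltmean mulrAC mulVf ?mul1r ?subrr//.
by rewrite gt_eqF// mesh_gt0.
Qed.

(** Replacing [w] by its means does not change the integral over any element;
    this is why [interp] interpolates at the nodes. *)
Lemma err_node_int0 k : (k <= N)%N -> (\int[mu]_(x in `[0%R, node N k]) err x = 0)%R.
Proof.
elim: k => [_|k IH kN]; first by rewrite node0 set_itv1 Rintegral_set1.
rewrite (Rintegral_itv_split _ _ _ (node N k)) ?node_ge0 ?node_le//; last first.
  by apply: err_integrable => //; exact: node_le1.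
by rewrite IH ?(ltnW kN)// err_elt_int0// addr0.
Qed.

Lemma interp_err c x : 0 <= x -> x <= 1 ->
  interp c x = c + (\int[mu]_(t in `[0%R, x]) w t)%R +
               (\int[mu]_(t in `[0%R, x]) err t)%R.
Proof.
move=> x0 x1; rewrite /interp /err RintegralB//; last first.
- exact: integrable_sub01.
- exact: meanstep_integrable.
by ring.
Qed.

Lemma interp_affine c k x : (k < N)%N -> x \in `[node N k, node N k.+1] ->
  interp c x = eltmean k * x + (interp c (node N k) - eltmean k * node N k).
Proof.
move=> kN; rewrite in_itv/= => /andP[kx xk].
rewrite /interp (Rintegral_itv_split _ 0 x (node N k)) ?node_ge0//; last first.
  exact: meanstep_integrable.
rewrite -(Rintegral_itv_oo meanstep (node N k) x); last exact: meanstep_integrable.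
rewrite (_ : (\int[mu]_(t in `]node N k, x[) meanstep t =
  \int[mu]_(t in `]node N k, x[) eltmean k)%R); last first.
  apply: eq_Rintegral => t /set_mem/=; rewrite in_itv/= => /andP[kt tx].
  rewrite /meanstep (stepfun_elt _ _ k)// /elt/= in_itv/= kt.
  exact: lt_le_trans tx xk.
rewrite Rintegral_cst; last exact: measurable_itv.
have -> : fine (mu `]node N k, x[) = x - node N k.
  rewrite lebesgue_measure_itv/= lte_fin; case: ltP => //= xk'.
  by rewrite (@le_anti _ _ x (node N k)) ?subrr// kx xk'.
by ring.
Qed.

Lemma interp_continuous c : {within `[0, 1], continuous (interp c)}.
Proof.
move=> x; apply: cvgD; first exact: cvg_cst.
exact: (parameterized_integral_continuous ler01 (meanstep_integrable 0 1)).
Qed.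

Lemma interp_weak_derivative c : is_weak_derivative (interp c) meanstep.
Proof.
apply: (fe_weak_derivative _ _ eltmean
  (fun k => interp c (node N k) - eltmean k * node N k) N0 (interp_continuous c)).
by move=> k kN x xk; apply: interp_affine => //; exact: subset_itv_oo_cc.
Qed.

Lemma interp_fe : interp 0 1 = 1 -> fe_space N (interp 0).
Proof.
move=> i1; split => //.
- exact: interp_continuous.
- move=> k kN; exists (eltmean k), (interp 0 (node N k) - eltmean k * node N k).
  by move=> x xk; apply: interp_affine => //; exact: subset_itv_oo_cc.
- by rewrite /interp set_itv1 Rintegral_set1 addr0.
Qed.

(** The error vanishes at the left node of the element containing [x], so only
    the integral inside that element contributes. *)
Lemma interp_err_le k x : (k < N)%N -> x \in `[node N k, node N k.+1] ->
  `|\int[mu]_(t in `[0%R, x]) err t|%R <=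
  (\int[mu]_(t in `[node N k, node N k.+1]) `|err t|)%R.
Proof.
move=> kN; rewrite in_itv/= => /andP[kx xk].
have n1 := node_le1 N k.+1 kN : _ <= (1 : R).
have x1 := le_trans xk n1.
rewrite (Rintegral_itv_split _ 0 x (node N k)) ?node_ge0//; last first.
  exact: err_integrable.
rewrite err_node_int0 ?(ltnW kN)// add0r.
apply: le_trans (@le_normr_Rintegral _ _ _ mu _ _ _ _) _ => //.
  by apply: err_integrable => //; exact: node_ge0.
rewrite [leRHS](Rintegral_itv_split _ _ _ x)//; last first.
  by apply: integrable_norm; apply: err_integrable => //; exact: node_ge0.
by rewrite lerDl Rintegral_ge0.
Qed.

Lemma node_itv_cover x : x \in `[(0 : R), 1] ->
  exists2 k, (k < N)%N & x \in `[node N k, node N k.+1].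
Proof.
rewrite in_itv/= => /andP[x0]; rewrite le_eqVlt => /predU1P[->|x1].
  (* The point 1 is the right end of the last element. *)
  exists N.-1; first by rewrite prednK.
  by rewrite in_itv/= prednK// nodeN// lexx andbT -(nodeN N N0) node_le// leq_pred.
have h0 : 0 < mesh N :> R by exact: mesh_gt0.
have Nx : 0 <= x * N%:R by rewrite mulr_ge0.
exists (Num.trunc (x * N%:R)).
  by rewrite truncn_lt_nat// -[ltRHS]mul1r ltr_pM2r// ltr0n.
have /andP[t1 t2] := truncn_itv Nx.
rewrite in_itv/= /node /mesh ler_pdivrMr ?ltr0n// t1/=.
by rewrite ler_pdivlMr ?ltr0n// ltW.
Qed.

Lemma elt_cover_ae : {ae mu, forall x : R, I01 x -> exists2 k, (k < N)%N & elt N k x}.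
Proof.
pose A : set R := range (node N).
have cA : countable A by exact: (card_image_le (node N) setT).
have : mu.-negligible A.
  exists A; split => //; first exact: countable_measurable.
  exact: countable_lebesgue_measure0.
apply: negligibleS => x /= /not_implyP[x01 nk].
have [k kN xk] : exists2 k, (k < N)%N & x \in `[node N k, node N k.+1].
  by apply: node_itv_cover; exact: subset_itv_oo_cc.
have [->|xk1] := eqVneq x (node N k); first by exists k.
have [->|xk2] := eqVneq x (node N k.+1); first by exists k.+1.
exfalso; apply: nk; exists k => //; move: xk; rewrite /elt/= !in_itv/=.
by rewrite !lt_neqAle xk2 eq_sym xk1.
Qed.

(** Integrating [interp_err_le] over an element multiplies by its length.  This
    factor [mesh N], which a uniform bound would lose, pays for the sixth power
    of the cut-off level in the energy estimate. *)
Lemma interp_err_L1 :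
  (\int[mu]_(x in `[0%R, 1%R]) `|\int[mu]_(t in `[0%R, x]) err t| <=
   mesh N * \int[mu]_(x in `[0%R, 1%R]) `|err x|)%R.
Proof.
pose D x := (\int[mu]_(t in `[0%R, x]) err t)%R.
have iD a b : 0 <= a -> b <= 1 -> mu.-integrable `[a, b] (EFin \o (fun x => `|D x|)).
  apply: integrable_sub01; apply: integrable_norm; apply: within_continuous_integrable.
  apply: (parameterized_integral_continuous ler01); exact: err_integrable.
have iE a b : 0 <= a -> b <= 1 -> mu.-integrable `[a, b] (EFin \o (fun x => `|err x|)).
  by move=> a0 b1; apply: integrable_norm; exact: err_integrable.
have claim m : (m <= N)%N -> (\int[mu]_(x in `[0%R, node N m]) `|D x| <=
   mesh N * \int[mu]_(x in `[0%R, node N m]) `|err x|)%R.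
  elim: m => [_|m IH mN]; first by rewrite node0 set_itv1 !Rintegral_set1 mulr0.
  have n1 := node_le1 N m.+1 mN : _ <= (1 : R).
  rewrite (Rintegral_itv_split _ _ _ (node N m)) ?node_ge0 ?node_le//; last exact: iD.
  rewrite [in leRHS](Rintegral_itv_split _ _ _ (node N m)) ?node_ge0 ?node_le//; last exact: iE.
  rewrite mulrDr lerD ?IH ?(ltnW mN)//.
  set I := (\int[mu]_(x in `[_, _]) `|err x|)%R.
  apply: le_trans (_ : _ <= (\int[mu]_(x in `[node N m, node N m.+1]) I)%R) _.
    apply: le_Rintegral => //.
    - by apply: iD => //; exact: node_ge0.
    - by apply: within_continuous_integrable; apply: continuous_subspaceT => x; exact: cvg_cst.
    - by move=> x /= xm; exact: interp_err_le.
  rewrite Rintegral_cst// mulrC ler_wpM2r//; first by exact: Rintegral_ge0.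
  rewrite (_ : fine _ = mesh N) //.
  have H : mu `[node N m, node N m.+1]%classic = (mesh N)%:E.
    rewrite lebesgue_measure_itv/= lte_fin node_lt// -EFinD; congr EFin.
    by rewrite nodeS; ring.
  exact: (congr1 fine H).
by have := claim N (leqnn N); rewrite nodeN.
Qed.

End Interpolation.

(** * Interpolation error in a fractional space *)

Section FractionalEstimate.
Context {R : realType}.
Notation mu := (@lebesgue_measure R).
Variables (w : R -> R) (s p : R).
Hypothesis mw : measurable_fun setT w.
Hypothesis s0 : 0 < s.
Hypothesis p1 : 1 <= p.

Definition slobkernel (x y : R) : R :=
  (`|w x - w y| `^ p) / (`|x - y| `^ (1 + s * p)).

Lemma slobkernel_ge0 x y : 0 <= slobkernel x y.
Proof. by rewrite mulr_ge0 ?invr_ge0 ?powR_ge0. Qed.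

Lemma measurable_slobkernel2 :
  measurable_fun setT (fun z : R * R => slobkernel z.1 z.2).
Proof.
rewrite (_ : (fun z : R * R => slobkernel z.1 z.2) = (fun z : R * R =>
    (`|w z.1 - w z.2| `^ p) * (`|z.1 - z.2| `^ (- (1 + s * p))))); last first.
  by apply/funext => z; rewrite /slobkernel powRN.
apply: measurable_funM.
  apply: (measurableT_comp (measurable_powR p)); apply: measurableT_comp => //.
  apply: measurable_funB.
    exact: (measurableT_comp mw measurable_fst).
  exact: (measurableT_comp mw measurable_snd).
apply: (measurableT_comp (measurable_powR _)); apply: measurableT_comp => //.
by apply: measurable_funB; [exact: measurable_fst|exact: measurable_snd].
Qed.

Lemma measurable_slobkernel x : measurable_fun setT (slobkernel x).
Proof.
exact: (measurableT_comp measurable_slobkernel2 (measurable_pair1 x)).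
Qed.

(** Tonelli's theorem, after extension of the kernel by zero in [y]. *)
Lemma measurable_slob_inner : measurable_fun (I01 : set R)
  (fun x => \int[mu]_(y in I01) (slobkernel x y)%:E)%E.
Proof.
pose f (z : R * R) := (slobkernel z.1 z.2 * \1_(I01 : set R) z.2)%:E.
have mf : measurable_fun setT f.
  apply/measurable_EFinP; apply: measurable_funM; first exact: measurable_slobkernel2.
  have mi : measurable_fun setT (\1_(I01 : set R) : R -> R).
    by apply: measurable_indic; exact: measurable_I01.
  exact: (measurableT_comp mi measurable_snd).
have f0 z : (0 <= f z)%E.
  by rewrite lee_fin mulr_ge0 ?slobkernel_ge0// indicE ler0n.
have := measurable_fun_fubini_tonelli_F (m2 := mu) f mf f0.
rewrite /fubini_F => H.
rewrite (_ : (fun x => _) = (fun x => \int[mu]_y f (x, y))%E).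
  exact: measurable_funTS H.
apply/funext => x; rewrite integral_mkcond; apply: eq_integral => y _.
by rewrite patchE /f /= indicE; case: (_ \in _); rewrite ?mulr1 ?mulr0.
Qed.

Variables (N : nat).
Hypothesis N0 : (0 < N)%N.
Hypothesis iw : mu.-integrable `[0, 1] (EFin \o w).

(** The error at [x] is the mean of w y - w x over the element of [x], so its
    p-th power is controlled by the mean of |w y - w x|^p.  On the element
    |x - y| <= mesh N, hence |w y - w x|^p is at most mesh^(1 + s p) times the
    kernel; enlarging the domain to (0, 1) gives a bound that no longer refers
    to the element. *)
Lemma meanstep_pointwise k x : (k < N)%N -> elt N k x ->
  ((`|meanstep N w x - w x| `^ p)%:E <=
   (2 `^ p * mesh N `^ (s * p))%:E * \int[mu]_(y in I01) (slobkernel x y)%:E)%E.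
Proof.
move=> kN xk.
have h0 : 0 < mesh N :> R by exact: mesh_gt0.
have melt : measurable (elt N k : set R) by exact: measurable_itv.
have sub01 : (elt N k : set R) `<=` `[0, 1].
  apply: subset_itv; rewrite bnd_simp ?node_ge0//; exact: node_le1.
have subI : (elt N k : set R) `<=` I01.
  apply: subset_itv; rewrite bnd_simp ?node_ge0//; exact: node_le1.
have iwe : mu.-integrable (elt N k) (EFin \o w) by apply: integrableS iw.
have ice : mu.-integrable (elt N k) (EFin \o (cst (w x))).
  apply: (@integrableS _ _ _ mu `[0, 1]) => //.
  by apply: within_continuous_integrable; apply: continuous_subspaceT => y; exact: cvg_cst.
have id := integrable_sub _ _ _ melt iwe ice.
have muE : mu (elt N k) = (mesh N)%:E by exact: mu_elt.
have mE : meanstep N w x - w x = (mesh N)^-1 * (\int[mu]_(y in elt N k) (w y - w x))%R.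
  rewrite RintegralB// Rintegral_cst// (_ : fine _ = mesh N); last exact: (congr1 fine muE).
  rewrite /meanstep (stepfun_elt _ _ k)// /eltmean mulrBr; congr (_ - _).
  by rewrite mulrCA mulVf ?mulr1// gt_eqF.
have in_ : mu.-integrable (elt N k) (EFin \o (fun y => `|w y - w x|)).
  exact: integrable_norm.
have mp : measurable_fun setT (fun y => `|w y - w x| `^ p).
  apply: (measurableT_comp (measurable_powR p)); apply: measurableT_comp => //.
  by apply: measurable_funB => //; exact: measurable_cst.
apply: (@le_trans _ _ (((mesh N)^-1 *
    (\int[mu]_(y in elt N k) `|w y - w x|)%R) `^ p)%:E).
  have I0 : 0 <= (\int[mu]_(y in elt N k) `|w y - w x|)%R by exact: Rintegral_ge0.
  have p0 : 0 <= p by exact: le_trans ler01 p1.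
  rewrite lee_fin ge0_ler_powR ?nnegrE//.
    by rewrite mulr_ge0// invr_ge0 ltW.
  have hV0 : 0 < (mesh N)^-1 :> R by rewrite invr_gt0.
  rewrite mE normrM (gtr0_norm hV0).
  rewrite ler_wpM2l ?(ltW hV0)//.
  exact: le_normr_Rintegral.
have nn y : elt N k y -> 0 <= `|w y - w x| by [].
have := mean_powR (elt N k) (fun y => `|w y - w x|) _ _ p1 h0 melt muE nn in_.
move=> /le_trans; apply.
have mk : measurable_fun (I01 : set R) (fun y => (slobkernel x y)%:E).
  by apply/measurable_EFinP; apply: measurable_funTS; exact: measurable_slobkernel.
have : (\int[mu]_(y in elt N k) (`|w y - w x| `^ p)%:E <=
    (mesh N `^ (1 + s * p))%:E * \int[mu]_(y in I01) (slobkernel x y)%:E)%E.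
  rewrite -ge0_integralZl//; last 3 first.
  - exact: measurable_I01.
  - by move=> y _; rewrite lee_fin slobkernel_ge0.
  - by rewrite lee_fin powR_ge0.
  apply: (@le_trans _ _ (\int[mu]_(y in elt N k)
     ((mesh N `^ (1 + s * p))%:E * (slobkernel x y)%:E))%E).
    apply: ge0_le_integral => //.
    - by apply/measurable_EFinP; exact: measurable_funTS mp.
    - by apply: measurable_funeM; exact: (measurable_funS measurable_I01 subI mk).
    - move=> y yk; rewrite -EFinM lee_fin /slobkernel.
      have [->|xy] := eqVneq y x.
        rewrite subrr normr0 powR0 ?mul0r ?mulr0//.
        by rewrite gt_eqF// (lt_le_trans ltr01).
      rewrite mulrCA distrC ler_peMr ?powR_ge0//.
      rewrite ler_pdivlMr ?powR_gt0 ?normr_gt0 ?subr_eq0 1?eq_sym// mul1r.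
      have sp0 : 0 <= 1 + s * p by rewrite addr_ge0// mulr_ge0 ?(ltW s0) ?(le_trans ler01 p1).
      rewrite ge0_ler_powR ?nnegrE ?(ltW h0)//.
      move: xk yk; rewrite /elt/= !in_itv/= nodeS => /andP[? ?] /andP[? ?].
      by rewrite ler_norml; lra.
  apply: ge0_subset_integral => //.
  - exact: measurable_I01.
  - exact: measurable_funeM.
  - by move=> y _; rewrite -EFinM lee_fin mulr_ge0 ?powR_ge0 ?slobkernel_ge0.
move=> H; apply: le_trans (lee_wpmul2l _ H) _.
  by rewrite lee_fin mulr_ge0 ?powR_ge0// invr_ge0 ltW.
rewrite muleA -EFinM le_eqVlt; apply/orP; left; apply/eqP; congr (_%:E * _)%E.
rewrite powRD; last by rewrite (gt_eqF h0) implybT.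
rewrite powRr1 ?(ltW h0)// -mulrA; congr (_ * _).
by rewrite mulrA mulVf ?mul1r// gt_eqF.
Qed.

Lemma meanstep_Lp :
  (\int[mu]_(x in I01) (`|meanstep N w x - w x| `^ p)%:E <=
   (2 `^ p * mesh N `^ (s * p))%:E * gagliardo s p w)%E.
Proof.
have C0 : 0 <= 2 `^ p * mesh N `^ (s * p) by rewrite mulr_ge0 ?powR_ge0.
have mI := @measurable_I01 R.
have G0 x : (0 <= \int[mu]_(y in I01) (slobkernel x y)%:E)%E.
  by apply: integral_ge0 => y _; rewrite lee_fin slobkernel_ge0.
rewrite /gagliardo -ge0_integralZl//; [|exact: measurable_slob_inner|by move=> x _; exact: G0].
apply: ae_ge0_le_integral => //.
- apply/measurable_EFinP; apply: measurable_funTS.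
  apply: (measurableT_comp (measurable_powR p)); apply: measurableT_comp => //.
  by apply: measurable_funB => //; exact: measurable_stepfun.
- by move=> x _; apply: mule_ge0; [rewrite lee_fin|exact: G0].
- by apply: measurable_funeM; exact: measurable_slob_inner.
- apply: ae_imply (elt_cover_ae N N0) => x H x01; have [k kN xk] := H x01.
  exact: meanstep_pointwise xk.
Qed.

End FractionalEstimate.

(** * Lebesgue norms on the unit interval *)

Section Norms.
Context {R : realType}.
Notation mu := (@lebesgue_measure R).
Implicit Types (u v w : R -> R) (p e : R).

Lemma Lp_norm_pow p u : p != 0 ->
  (Lp_norm p u `^ p = \int[mu]_(x in I01) (`|u x| `^ p)%:E)%E.
Proof.
move=> p0; rewrite /Lp_norm powR_Lnorm//.
rewrite [RHS]integral_mkcond; apply: eq_integral => x _ /=.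
by rewrite !patchE; case: ifP => // _; rewrite normr0 powR0.
Qed.

Lemma Lp_normE p u : p != 0 ->
  Lp_norm p u = ((\int[mu]_(x in I01) (`|u x| `^ p)%:E) `^ p^-1)%E.
Proof.
by move=> p0; rewrite -Lp_norm_pow// -poweRrM mulfV// poweRe1// Lnorm_ge0.
Qed.

Lemma Lp_norm_ge0 p u : (0 <= Lp_norm p u)%E.
Proof. exact: Lnorm_ge0. Qed.

Lemma Lp_norm_le p u e : 0 < p -> 0 <= e ->
  (\int[mu]_(x in I01) (`|u x| `^ p)%:E <= (e `^ p)%:E)%E ->
  (Lp_norm p u <= e%:E)%E.
Proof.
move=> p0 e0 H; rewrite Lp_normE ?gt_eqF//.
have -> : e%:E = ((e `^ p)%:E `^ p^-1)%E.
  by rewrite poweR_EFin -powRrM mulfV ?gt_eqF// powRr1.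
apply: gt0_ler_poweR => //; first by rewrite invr_ge0 ltW.
- by rewrite in_itv/= leey andbT integral_ge0// => x _; rewrite lee_fin powR_ge0.
- by rewrite in_itv/= leey lee_fin powR_ge0.
Qed.

Lemma in_Lp_measurable p u : in_Lp p u -> measurable_fun setT (u \_ I01).
Proof. by rewrite /in_Lp inE => /andP[]; rewrite inE. Qed.

Lemma in_Lp_integral p u : 0 < p -> in_Lp p u ->
  (\int[mu]_(x in I01) (`|u x| `^ p)%:E < +oo)%E.
Proof.
move=> p0; rewrite /in_Lp inE => /andP[_]; rewrite inE /= /finite_norm => H.
by rewrite -Lp_norm_pow ?gt_eqF//; apply: poweR_lty.
Qed.

End Norms.

(** * Comparison of energy densities *)

Section Pointwise.
Context {R : realType}.
Implicit Types (a b L M u x y z : R).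

Lemma subrX_le a b L n : `|a| <= L -> `|b| <= L ->
  `|a ^+ n.+1 - b ^+ n.+1| <= n.+1%:R * L ^+ n * `|a - b|.
Proof.
move=> aL bL; have L0 : 0 <= L by exact: le_trans aL.
rewrite subrXX normrM mulrC ler_wpM2r//.
apply: le_trans (ler_norm_sum _ _ _) _.
rewrite mulr_natl -[n.+1 in leRHS]card_ord -sumr_const; apply: ler_sum => i _.
rewrite normrM !normrX /=.
rewrite (le_trans (_ : _ <= L ^+ (n - i) * L ^+ i))//.
  by rewrite ler_pM ?exprn_ge0// lerXn2r ?nnegrE.
by rewrite -exprD subnK// -ltnS.
Qed.

(** The left-hand side is the sum of a^6 ((u^3 - x)^2 - (y^3 - x)^2),
    (a^6 - b^6) (y^3 - x)^2 and b^6 (y^3 - x)^2.  The lemma is used with [a] and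
    [b] the cut-off slopes of the interpolant and of the limit, [L] the cut-off
    level and [z] the slope of the limit: the last term is then at most the
    exact density, and the errors cost L^6 and L^5. *)
Lemma mania_pointwise a b L u y x z M : `|a| <= L -> `|b| <= L -> `|b| <= `|z| ->
  0 <= x -> x <= 1 -> `|u| <= M -> `|y| <= M ->
  a ^+ 6 * (u ^+ 3 - x) ^+ 2 <= z ^+ 6 * (y ^+ 3 - x) ^+ 2 +
    (6 * (M ^+ 3 + 1) ^+ 2 * L ^+ 5 * `|a - b| +
     6 * M ^+ 2 * (M ^+ 3 + 1) * L ^+ 6 * `|u - y|).
Proof.
move=> aL bL bz x0 x1 uM yM.
have L0 : 0 <= L by exact: le_trans aL.
have M0 : 0 <= M by exact: le_trans uM.
have even6 (c : R) : c ^+ 6 = (c ^+ 3) ^+ 2 by rewrite -exprM.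
have bnd t : `|t| <= M -> `|t ^+ 3 - x| <= M ^+ 3 + 1.
  move=> tM; apply: le_trans (ler_normB _ _) _; rewrite lerD//.
    by rewrite normrX lerXn2r ?nnegrE.
  by rewrite ger0_norm.
have h1 : a ^+ 6 * ((u ^+ 3 - x) ^+ 2 - (y ^+ 3 - x) ^+ 2) <=
    6 * M ^+ 2 * (M ^+ 3 + 1) * L ^+ 6 * `|u - y|.
  apply: le_trans (ler_norm _) _; rewrite normrM normrX subr_sqr normrM.
  have e1 : `|u ^+ 3 - x - (y ^+ 3 - x)| <= 3 * M ^+ 2 * `|u - y|.
    have -> : u ^+ 3 - x - (y ^+ 3 - x) = u ^+ 3 - y ^+ 3 by ring.
    exact: subrX_le.
  have e2 : `|u ^+ 3 - x + (y ^+ 3 - x)| <= 2 * (M ^+ 3 + 1).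
    by apply: le_trans (ler_normD _ _) _; have := bnd u uM; have := bnd y yM; lra.
  have e3 : `|a| ^+ 6 <= L ^+ 6 by rewrite lerXn2r ?nnegrE.
  have -> : 6 * M ^+ 2 * (M ^+ 3 + 1) * L ^+ 6 * `|u - y| =
     L ^+ 6 * ((3 * M ^+ 2 * `|u - y|) * (2 * (M ^+ 3 + 1))) by ring.
  by rewrite ler_pM ?exprn_ge0 ?mulr_ge0// ler_pM.
have h2 : (a ^+ 6 - b ^+ 6) * (y ^+ 3 - x) ^+ 2 <=
    6 * (M ^+ 3 + 1) ^+ 2 * L ^+ 5 * `|a - b|.
  apply: le_trans (ler_norm _) _; rewrite normrM.
  have e1 := subrX_le a b L 5 aL bL.
  have e2 : `|(y ^+ 3 - x) ^+ 2| <= (M ^+ 3 + 1) ^+ 2.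
    by rewrite normrX lerXn2r ?nnegrE ?addr_ge0 ?exprn_ge0// bnd.
  have -> : 6 * (M ^+ 3 + 1) ^+ 2 * L ^+ 5 * `|a - b| =
     (6 * L ^+ 5 * `|a - b|) * (M ^+ 3 + 1) ^+ 2 by ring.
  by rewrite ler_pM.
have h3 : b ^+ 6 * (y ^+ 3 - x) ^+ 2 <= z ^+ 6 * (y ^+ 3 - x) ^+ 2.
  rewrite ler_wpM2r ?sqr_ge0//.
  have pe (c : R) : c ^+ 6 = `|c| ^+ 6.
    by rewrite -normrX ger0_norm// even6 sqr_ge0.
  by rewrite (pe b) (pe z) lerXn2r ?nnegrE.
have -> : a ^+ 6 * (u ^+ 3 - x) ^+ 2 = b ^+ 6 * (y ^+ 3 - x) ^+ 2 +
    ((a ^+ 6 - b ^+ 6) * (y ^+ 3 - x) ^+ 2 +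
     a ^+ 6 * ((u ^+ 3 - x) ^+ 2 - (y ^+ 3 - x) ^+ 2)) by ring.
by apply: lerD h3 _; apply: lerD h2 h1.
Qed.

End Pointwise.

(** * Powers of the mesh size *)

Section Rates.
Context {R : realType}.

Lemma mesh_cvg0 : (mesh N : R) @[N --> \oo] --> (0 : R).
Proof. by rewrite -(cvg_shiftS (fun N => mesh N : R)); exact: cvg_harmonic. Qed.

Lemma powR_seq_cvg0 (u : nat -> R) (d : R) : 0 < d -> (forall n, 0 <= u n) ->
  u n @[n --> \oo] --> (0 : R) -> (u n `^ d) @[n --> \oo] --> (0 : R).
Proof.
move=> d0 u0 cu; apply/cvgrPdist_le => e e0.
have ed : 0 < e `^ d^-1 by rewrite powR_gt0.
near=> n; rewrite sub0r normrN ger0_norm ?powR_ge0//.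
have -> : e = (e `^ d^-1) `^ d by rewrite -powRrM mulVf ?gt_eqF// powRr1// ltW.
rewrite ge0_ler_powR ?nnegrE ?(ltW d0) ?(ltW ed)//.
have : `|0 - u n| <= e `^ d^-1 by near: n; move/cvgrPdist_le : cu; exact.
by rewrite sub0r normrN ger0_norm.
Unshelve. all: by end_near. Qed.

Lemma mesh_powR_cvg0 (d : R) : 0 < d -> (mesh N `^ d) @[N --> \oo] --> (0 : R).
Proof.
move=> d0; apply: powR_seq_cvg0 => //; last exact: mesh_cvg0.
by move=> n; rewrite /mesh invr_ge0.
Qed.

End Rates.

(** * The recovery sequence *)

Section Recovery.
Context {R : realType}.
Notation mu := (@lebesgue_measure R).
Variables (s p alpha : R) (v w : R -> R).
Hypothesis s0 : 0 < s.
Hypothesis p1 : 1 <= p.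
Hypothesis cv : {within `[(0 : R), 1], continuous v}.
Hypothesis v0 : v 0 = 0.
Hypothesis v1 : v 1 = 1.
Hypothesis vw : is_weak_derivative v w.
Hypothesis mw : measurable_fun setT w.
Hypothesis iw : mu.-integrable `[0, 1] (EFin \o w).
Hypothesis gag : (gagliardo s p w < +oo)%E.

Let V N := interp N w 0.
Let G0 := fine (gagliardo s p w).
Let C1 := 1 + 2 `^ p * G0.
Let mI := @measurable_I01 R.
Let sub01 : (@I01 R) `<=` `[0, 1].
Proof. exact: subset_itv_oo_cc. Qed.

Let gagE : gagliardo s p w = G0%:E.
Proof.
rewrite /G0 fineK// ge0_fin_numE// integral_ge0// => x _.
by apply: integral_ge0 => y _; rewrite lee_fin mulr_ge0 ?invr_ge0 ?powR_ge0.
Qed.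

Let G00 : 0 <= G0.
Proof.
rewrite fine_ge0// integral_ge0// => x _.
by apply: integral_ge0 => y _; rewrite lee_fin mulr_ge0 ?invr_ge0 ?powR_ge0.
Qed.

Let C10 : 0 <= C1.
Proof. by rewrite addr_ge0// mulr_ge0 ?powR_ge0. Qed.

Lemma mu_I01 : mu (@I01 R) = 1%E.
Proof. by rewrite /I01 lebesgue_measure_itv/= lte_fin ltr01 sube0. Qed.

Lemma integral_cst_I01 (c : R) : (\int[mu]_(x in I01) c%:E = c%:E)%E.
Proof.
transitivity (c%:E * 1)%E; last by rewrite mule1.
rewrite (integral_cst mu mI c%:E); congr (_ * _)%E; exact: mu_I01.
Qed.

Lemma Rintegral_I01 f : mu.-integrable `[0, 1] (EFin \o f) ->
  (\int[mu]_(x in I01) (f x)%:E = (\int[mu]_(x in `[0%R, 1%R]) f x)%:E)%E.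
Proof.
move=> fi; rewrite -Rintegral_itv_oo// /Rintegral fineK//.
apply: integrable_fin_num => //; apply: (@integrableS _ _ _ mu `[0, 1]) => //.
Qed.

Lemma interp_sub N x : (0 < N)%N -> x \in `[0, 1] ->
  V N x - v x = (\int[mu]_(t in `[0, x]) (meanstep N w t - w t))%R.
Proof.
move=> N0; move=> /[dup] x01; rewrite in_itv/= => /andP[x0 x1].
rewrite /V interp_err// add0r -(weak_derivative_FTC v w cv vw iw)// v0 subr0.
by ring.
Qed.

Lemma interp_at1 N : (0 < N)%N -> V N 1 = 1.
Proof.
move=> N0; apply/eqP; rewrite -{2}v1 -subr_eq0 interp_sub// ?in_itv/= ?ler01 ?lexx//.
by rewrite -(nodeN N N0) err_node_int0.
Qed.

Lemma interp_fe_space N : (0 < N)%N -> fe_space N (V N).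
Proof. by move=> N0; apply: interp_fe => //; exact: interp_at1. Qed.

Lemma err_Lp N : (0 < N)%N ->
  (\int[mu]_(x in I01) (`|meanstep N w x - w x| `^ p)%:E <=
   (2 `^ p * mesh N `^ (s * p) * G0)%:E)%E.
Proof. by move=> N0; rewrite EFinM -gagE; exact: meanstep_Lp. Qed.

Lemma ierr N : mu.-integrable `[0, 1] (EFin \o (fun x => meanstep N w x - w x)).
Proof. by apply: integrable_sub => //; exact: stepfun_integrable. Qed.

(** [le_add_powR] with c = mesh^s turns the L^p rate into the same L^1 rate. *)
Lemma err_L1 N : (0 < N)%N ->
  (\int[mu]_(x in `[0%R, 1%R]) `|meanstep N w x - w x|)%R <= mesh N `^ s * C1.
Proof.
move=> N0; have h0 : 0 < mesh N :> R by exact: mesh_gt0.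
pose c := mesh N `^ s : R; have c0 : 0 < c by rewrite powR_gt0.
have iE : mu.-integrable `[0, 1] (EFin \o (fun x => `|meanstep N w x - w x|)).
  by apply: integrable_norm; exact: ierr.
rewrite -lee_fin -Rintegral_I01//.
have me : measurable_fun (I01 : set R) (fun x => meanstep N w x - w x).
  by apply: measurable_funB; [exact: measurable_stepfun|exact: measurable_funTS].
have mep : measurable_fun (I01 : set R) (fun x => (`|meanstep N w x - w x| `^ p)%:E).
  apply/measurable_EFinP; apply: (measurableT_comp (measurable_powR p)).
  exact: measurableT_comp.
apply: (@le_trans _ _ (\int[mu]_(x in I01) (c%:E +
   (c `^ (1 - p))%:E * (`|meanstep N w x - w x| `^ p)%:E))%E).
  apply: ge0_le_integral => //.
  - by apply/measurable_EFinP; exact: measurableT_comp.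
  - by apply: emeasurable_funD => //; exact: measurable_funeM.
  - by move=> x _; rewrite -EFinM -EFinD lee_fin le_add_powR.
rewrite ge0_integralD//; last 3 first.
- by move=> x _; rewrite lee_fin ltW.
- by move=> x _; rewrite -EFinM lee_fin mulr_ge0 ?powR_ge0.
- exact: measurable_funeM.
rewrite integral_cst_I01 ge0_integralZl//; last by rewrite lee_fin powR_ge0.
apply: (@le_trans _ _ (c%:E + (c `^ (1 - p))%:E *
    (2 `^ p * mesh N `^ (s * p) * G0)%:E)%E).
  by rewrite leeD2l// lee_wpmul2l ?lee_fin ?powR_ge0//; exact: err_Lp.
rewrite -EFinM -EFinD lee_fin /C1 mulrDr mulr1 lerD2l le_eqVlt; apply/orP; left.
apply/eqP; transitivity (c `^ (1 - p) * mesh N `^ (s * p) * (2 `^ p * G0)); first by ring.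
congr (_ * _); rewrite /c -powRrM -powRD ?(gt_eqF h0) ?implybT//.
by congr (_ `^ _); ring.
Qed.

Lemma interp_sub_le N x : (0 < N)%N -> x \in `[0, 1] ->
  `|V N x - v x| <= mesh N `^ s * C1.
Proof.
move=> N0 x01; rewrite interp_sub//; apply: le_trans (err_L1 N N0).
move: x01; rewrite in_itv/= => /andP[x0 x1].
have sub : (`[0, x] : set R) `<=` `[0, 1] by apply: subset_itvl; rewrite bnd_simp.
apply: le_trans (@le_normr_Rintegral _ _ _ mu _ _ _ _) _ => //.
  by apply: integrableS (ierr N).
rewrite [leRHS](Rintegral_itv_split _ _ _ x)//; last first.
  by apply: integrable_norm; exact: ierr.
by rewrite lerDl Rintegral_ge0.
Qed.

Lemma interp_sub_L1 N : (0 < N)%N ->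
  (\int[mu]_(x in `[0%R, 1%R]) `|V N x - v x|)%R <= mesh N * (mesh N `^ s * C1).
Proof.
move=> N0; rewrite (_ : (\int[mu]_(x in `[0%R, 1%R]) `|V N x - v x|)%R =
  (\int[mu]_(x in `[0%R, 1%R]) `|\int[mu]_(t in `[0%R, x]) (meanstep N w t - w t)|)%R).
  apply: le_trans (interp_err_L1 N w N0 iw) _.
  by rewrite ler_wpM2l ?err_L1// ltW// mesh_gt0.
by apply: eq_Rintegral => x; rewrite inE/= => x01; rewrite interp_sub.
Qed.

Lemma V_weak_derivative N : (0 < N)%N -> is_weak_derivative (V N) (meanstep N w).
Proof. by move=> N0; exact: interp_weak_derivative. Qed.

Lemma interp_cvg_W1p : cvg_W1p p V v.
Proof.
have p0 : 0 < p by exact: lt_le_trans ltr01 p1.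
pose e N : R := mesh N `^ s * C1 + mesh N `^ s * (2 `^ p * G0) `^ p^-1.
apply: (@squeeze_cvge _ _ _ _ (cst 0%E) _ (EFin \o e)).
- near=> N; have N0 : (0 < N)%N by near: N; exists 1%N.
  apply/andP; split; first by rewrite /W1p_norm adde_ge0// Lp_norm_ge0.
  rewrite /W1p_norm /e /= EFinD leeD//.
    apply: Lp_norm_le => //; first by rewrite mulr_ge0// powR_ge0.
    apply: (@le_trans _ _ (\int[mu]_(x in I01) ((mesh N `^ s * C1) `^ p)%:E)%E).
      apply: ge0_le_integral => //.
      + apply/measurable_EFinP; apply: (measurableT_comp (measurable_powR p)).
        apply: measurableT_comp => //; apply: measurable_funB.
          by apply: measurable_funS (within_continuous_measurable _ _ _ (interp_continuous N w 0)).
        by apply: measurable_funS (within_continuous_measurable _ _ _ cv).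
      + move=> x x01; rewrite lee_fin ge0_ler_powR ?nnegrE ?(ltW p0)//.
          by rewrite mulr_ge0// powR_ge0.
        by apply: interp_sub_le => //; exact: sub01.
    by rewrite integral_cst_I01.
  apply: Lp_norm_le => //; first by rewrite mulr_ge0 ?powR_ge0.
  have VvD := weak_derivativeB _ _ _ _ (V_weak_derivative N N0) vw.
  have [_ [mwd _ _] _] := wderivP _ _ VvD.
  rewrite (@ge0_ae_eq_integral _ _ _ mu I01 _
     (fun x => (`|meanstep N w x - w x| `^ p)%:E))//.
  + apply: le_trans (err_Lp N N0) _; rewrite lee_fin le_eqVlt; apply/orP; left; apply/eqP.
    rewrite powRM ?powR_ge0// -powRrM -powRrM mulVf ?gt_eqF// powRr1.
      by ring.
    by rewrite mulr_ge0 ?powR_ge0.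
  + apply/measurable_EFinP; apply: (measurableT_comp (measurable_powR p)).
    exact: measurableT_comp.
  + apply/measurable_EFinP; apply: (measurableT_comp (measurable_powR p)).
    apply: measurableT_comp => //; apply: measurable_funB.
      exact: measurable_stepfun.
    exact: measurable_funTS.
  + by apply: ae_imply (wderiv_ae _ _ VvD) => x H /H ->.
- exact: cvg_cst.
- apply: cvg_EFin; first exact: nearW.
  rewrite [X in _ --> X](_ : _ = 0 * C1 + 0 * (2 `^ p * G0) `^ p^-1); last first.
    by rewrite !mul0r addr0.
  by apply: cvgD; apply: cvgMr_tmp; exact: mesh_powR_cvg0.
Unshelve. all: by end_near. Qed.

(** Integrate [mania_pointwise] with L = mesh^(-alpha): the L^1 errors of the
    slopes and of the values are of order mesh^s and mesh^(1 + s). *)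
Lemma interp_energy_le : exists B1 B2 : R, forall N, (0 < N)%N ->
  (Jh (mesh N) alpha (V N) <=
   J v + (B1 * mesh N `^ (s - 5 * alpha) + B2 * mesh N `^ (1 + s - 6 * alpha))%:E)%E.
Proof.
have [M M0 vM] := within_continuous_bounded _ _ _ cv.
(* A bound for v and, since mesh^s <= 1, for all its interpolants. *)
pose M2 := M + C1.
exists (6 * (M2 ^+ 3 + 1) ^+ 2 * C1), (6 * M2 ^+ 2 * (M2 ^+ 3 + 1) * C1) => N N0.
have h0 : 0 < mesh N :> R by exact: mesh_gt0.
have h1 : mesh N <= 1 :> R by exact: mesh_le1.
pose L := mesh N `^ (- alpha) : R; have L0 : 0 <= L by exact: powR_ge0.
have M20 : 0 <= M2 by rewrite addr_ge0.
pose A1 := 6 * (M2 ^+ 3 + 1) ^+ 2 * L ^+ 5.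
pose A2 := 6 * M2 ^+ 2 * (M2 ^+ 3 + 1) * L ^+ 6.
have M30 : 0 <= M2 ^+ 3 + 1 by rewrite addr_ge0// exprn_ge0.
have A10 : 0 <= A1 by rewrite /A1 !mulr_ge0// ?exprn_ge0.
have A20 : 0 <= A2 by rewrite /A2 !mulr_ge0// ?exprn_ge0.
have [_ [mwV _ _] _] := wderivP _ _ (V_weak_derivative N N0).
have [_ [mwv _ _] _] := wderivP _ _ vw.
have mV : measurable_fun (I01 : set R) (V N).
  by apply: measurable_funS (within_continuous_measurable _ _ _ (interp_continuous N w 0)).
have mv : measurable_fun (I01 : set R) v.
  by apply: measurable_funS (within_continuous_measurable _ _ _ cv).
have mcube (u : R -> R) : measurable_fun (I01 : set R) u ->
    measurable_fun (I01 : set R) (fun x => (u x ^+ 3 - x) ^+ 2).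
  move=> mu_; apply: measurable_funX; apply: measurable_funB => //.
  exact: measurable_funX.
have mF : measurable_fun (I01 : set R)
    (fun x => (wderiv v x ^+ 6 * (v x ^+ 3 - x) ^+ 2)%:E).
  apply/measurable_EFinP; apply: measurable_funM; last exact: mcube.
  exact: measurable_funX.
have mE1 : measurable_fun (I01 : set R) (fun x => (`|meanstep N w x - w x|)%:E).
  apply/measurable_EFinP; apply: measurableT_comp => //; apply: measurable_funB.
    exact: measurable_stepfun.
  exact: measurable_funTS.
have mE2 : measurable_fun (I01 : set R) (fun x => (`|V N x - v x|)%:E).
  by apply/measurable_EFinP; apply: measurableT_comp => //; exact: measurable_funB.
have F0 x : (0 <= (wderiv v x ^+ 6 * (v x ^+ 3 - x) ^+ 2)%:E)%E.
  by rewrite lee_fin mulr_ge0 ?exprn_even_ge0.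
apply: (@le_trans _ _ (\int[mu]_(x in I01)
    ((wderiv v x ^+ 6 * (v x ^+ 3 - x) ^+ 2)%:E +
     (A1%:E * (`|meanstep N w x - w x|)%:E + A2%:E * (`|V N x - v x|)%:E)))%E).
  apply: ae_ge0_le_integral => //.
  - by move=> x _; rewrite lee_fin mulr_ge0 ?exprn_even_ge0.
  - apply/measurable_EFinP; apply: measurable_funM; last exact: mcube.
    by apply: measurable_funX; exact: (measurableT_comp (measurable_chi _ _)).
  - by move=> x _; rewrite adde_ge0// adde_ge0// -EFinM lee_fin mulr_ge0.
  - by apply: emeasurable_funD => //; apply: emeasurable_funD; exact: measurable_funeM.
  - apply: (ae_imply2 _ _ _ _ (wderiv_ae _ _ (V_weak_derivative N N0)) (wderiv_ae _ _ vw)).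
    move=> x HV Hv x01; rewrite (HV x01) (Hv x01) -!EFinM -!EFinD lee_fin.
    have x01' := sub01 _ x01.
    have := x01; rewrite /I01/= in_itv/= => /andP[/ltW x0 /ltW x1].
    have VM : `|V N x| <= M2.
      rewrite -(subrK (v x) (V N x)) (le_trans (ler_normD _ _))// addrC lerD ?vM//.
      apply: le_trans (interp_sub_le N x N0 x01') _; rewrite ler_piMl//.
      have <- : 1 `^ s = 1 :> R by rewrite powR1.
      by rewrite ge0_ler_powR ?nnegrE// ltW.
    have vM2 : `|v x| <= M2 by rewrite (le_trans (vM _ x01'))// lerDl.
    apply: le_trans (mania_pointwise _ (chi (mesh N) alpha (w x)) L _ _ _ (w x) M2
      (chi_norm_le _ _ _) (chi_norm_le _ _ _) (chi_norm_le_id _ _ _) x0 x1 VM vM2) _.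
    by rewrite lerD2l lerD2r ler_wpM2l// chi_lipschitz.
rewrite ge0_integralD//; last 2 first.
- by move=> x _; rewrite adde_ge0// -EFinM lee_fin mulr_ge0.
- by apply: emeasurable_funD; exact: measurable_funeM.
rewrite leeD2l// ge0_integralD//; last 4 first.
- by move=> x _; rewrite -EFinM lee_fin mulr_ge0.
- exact: measurable_funeM.
- by move=> x _; rewrite -EFinM lee_fin mulr_ge0.
- exact: measurable_funeM.
rewrite !ge0_integralZl// ?lee_fin// Rintegral_I01; last first.
  by apply: integrable_norm; exact: ierr.
rewrite Rintegral_I01; last first.
  apply: integrable_norm; apply: within_continuous_integrable => x.
  by apply: cvgB; [exact: interp_continuous|exact: cv].
rewrite -!EFinM -EFinD lee_fin lerD//.
- apply: (@le_trans _ _ (A1 * (mesh N `^ s * C1))); first by rewrite ler_wpM2l ?err_L1.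
  rewrite le_eqVlt; apply/orP; left; apply/eqP.
  rewrite powRD ?(gt_eqF h0) ?implybT// /A1 /L -powR_mulrn ?powR_ge0// -powRrM.
  have -> : - alpha * 5 = - (5 * alpha) by ring.
  by ring.
- apply: (@le_trans _ _ (A2 * (mesh N * (mesh N `^ s * C1)))).
    by rewrite ler_wpM2l ?interp_sub_L1.
  rewrite le_eqVlt; apply/orP; left; apply/eqP.
  rewrite !powRD ?(gt_eqF h0) ?implybT// powRr1 ?(ltW h0)//.
  rewrite /A2 /L -powR_mulrn ?powR_ge0// -powRrM.
  have -> : - alpha * 6 = - (6 * alpha) by ring.
  by ring.
Qed.

End Recovery.

(** * Integrability of p-integrable functions *)

Section LpIntegrable.
Context {R : realType}.
Notation mu := (@lebesgue_measure R).

(** Domination by 1 + |w|^p. *)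
Lemma Lp_integrable01 (w : R -> R) (p : R) : measurable_fun setT w -> 1 <= p ->
  (\int[mu]_(x in I01) (`|w x| `^ p)%:E < +oo)%E ->
  mu.-integrable `[0, 1] (EFin \o w).
Proof.
move=> mw p1 wp; have mI := @measurable_I01 R.
apply/integrableP; split; first by apply/measurable_EFinP; exact: measurable_funTS.
have mwI : measurable_fun (I01 : set R) w by exact: measurable_funTS.
have mp : measurable_fun (I01 : set R) (fun x => (`|w x| `^ p)%:E).
  apply/measurable_EFinP; apply: (measurableT_comp (measurable_powR p)).
  exact: measurableT_comp.
have mn : measurable_fun (I01 : set R) (fun x => `|(EFin \o w) x|%E).
  by apply: measurableT_comp => //; exact/measurable_EFinP.
rewrite (integral_itv_bndoo _ _ mn).
apply: (@le_lt_trans _ _ (\int[mu]_(x in I01) (1%:E + (`|w x| `^ p)%:E))%E).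
  apply: ge0_le_integral => //.
  - by apply: emeasurable_funD.
  - move=> x _ /=; rewrite -EFinD lee_fin.
    by have := @le_add_powR R 1 `|w x| p ltr01 (normr_ge0 _) p1; rewrite powR1 mul1r.
by rewrite ge0_integralD// integral_cst_I01 lte_add_pinfty ?ltry.
Qed.

End LpIntegrable.

(** * Limits inferior and superior *)

Section Limits.
Context {R : realType}.
Notation mu := (@lebesgue_measure R).
Local Open Scope ereal_scope.
Implicit Types (u : nat -> \bar R) (l : \bar R).

Lemma limn_esup_le_near u t : (\forall n \near \oo, u n <= t n) ->
  limn_esup u <= limn_esup t.
Proof.
move=> ut; rewrite /limn_esup /limf_esup; apply: le_ereal_inf_tmp => _ [A fA <-].
apply: ge_ereal_inf; exists (ereal_sup [set u x | x in A `&` [set n | u n <= t n]]).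
  by exists (A `&` [set n | u n <= t n]) => //; exact: filterI.
apply: ge_ereal_sup => _ [n [An un] <-]; apply: (le_trans un).
by apply: ereal_sup_ubound; exists n.
Qed.

Lemma limn_esup_le_cvg_near u t l : (\forall n \near \oo, u n <= t n) ->
  t @ \oo --> l -> limn_esup u <= l.
Proof.
by move=> ut /cvg_limn_einf_sup [_ <-]; exact: limn_esup_le_near.
Qed.

Lemma le_limn_einf_near u l : (\forall n \near \oo, l <= u n) -> l <= limn_einf u.
Proof.
move=> lu; rewrite /limn_einf leeNr; apply: (@limn_esup_le_cvg_near _ (cst (- l))).
  by apply: filterS lu => n; rewrite leeN2.
exact: cvg_cst.
Qed.

Lemma limn_einf_lt_frequently u l : limn_einf u < l ->
  forall m, exists2 n, (m <= n)%N & u n < l.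
Proof.
move=> ul m; apply: contrapT => H; move: ul; apply/negP; rewrite -leNgt.
apply: le_limn_einf_near; exists m => // n /= mn; rewrite leNgt; apply/negP => un.
by apply: H; exists n.
Qed.

Lemma limn_esup_lt_near u l : limn_esup u < l -> \forall n \near \oo, u n <= l.
Proof.
rewrite /limn_esup /limf_esup => /ereal_inf_lt [_ [A fA <-] Al].
apply: filterS fA => n An; apply: (le_trans _ (ltW Al)).
by apply: ereal_sup_ubound; exists n.
Qed.

Lemma le_of_forall_lt_le (a b : \bar R) : (forall c, a < c -> b <= c) -> b <= a.
Proof.
case: a => [a| |] H; [|exact: leey|].
- apply/lee_addgt0Pr => e e0; apply: H.
  by rewrite -EFinD lte_fin ltrDl.
- rewrite leeNy_eq; apply/eqP; case: b H => [b| |//] H; exfalso.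
    have := H (b - 1)%:E; rewrite ltNyr lee_fin => /(_ isT).
    by rewrite lerBrDr gerDl ler10.
  by have := H 0; rewrite ltNyr => /(_ isT).
Qed.

End Limits.

(** * Almost everywhere convergence *)

Section AeSubsequence.
Context {R : realType}.
Notation mu := (@lebesgue_measure R).

(** The p-th powers have summable integrals, so their sum is integrable, hence
    finite almost everywhere, and the terms of a finite sum tend to 0. *)
Lemma Lp_fast_cvg_ae (f : nat -> R -> R) (p : R) : 0 < p ->
  (forall k, measurable_fun (I01 : set R) (f k)) ->
  (forall k, (\int[mu]_(x in I01) (`|f k x| `^ p)%:E <= (1 / (2 ^ k.+1)%:R)%:E)%E) ->
  {ae mu, forall x, I01 x -> f k x @[k --> \oo] --> (0 : R)}.
Proof.
move=> p0 mf Hf.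
have mI := @measurable_I01 R.
pose g k x := (`|f k x| `^ p)%:E.
have mg k : measurable_fun (I01 : set R) (g k).
  apply/measurable_EFinP; apply: (measurableT_comp (measurable_powR p)).
  exact: measurableT_comp.
have g0 k x : (0 <= g k x)%E by rewrite lee_fin powR_ge0.
have S0 x : (0 <= \sum_(k <oo) g k x)%E by apply: nneseries_ge0.
have mS : measurable_fun (I01 : set R) (fun x => \sum_(k <oo) g k x)%E.
  exact: ge0_emeasurable_sum.
have iS : mu.-integrable I01 (fun x => \sum_(k <oo) g k x)%E.
  apply/integrableP; split => //.
  under eq_integral do rewrite gee0_abs//.
  rewrite integral_nneseries//.
  apply: le_lt_trans (_ : (_ <= \sum_(k <oo) (1 / (2 ^ k.+1)%:R)%:E)%E) _.
    by apply: lee_nneseries => [k _ _|k _]; [exact: integral_ge0|exact: Hf].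
  by apply: le_lt_trans (epsilon_trick0 xpredT ler01) _; rewrite ltry.
have /= := @integrable_ae _ _ _ mu _ mI _ iS; apply: ae_imply => x H x01.
have {}H := H x01.
have tail : (\sum_(N <= k <oo) g k x)%E @[N --> \oo] --> 0%E.
  by apply: nneseries_tail_cvg => //; rewrite -ge0_fin_numE.
have gN : (g N x) @[N --> \oo] --> 0%E.
  apply: (@squeeze_cvge _ _ _ _ (cst 0%E) _ (fun N => \sum_(N <= k <oo) g k x)%E) => //.
    apply: nearW => N; rewrite g0/=.
    have := @nneseries_lim_ge R (fun k => g k x) xpredT N N.+1 (fun k _ _ => g0 k x).
    by rewrite big_nat1.
  exact: cvg_cst.
have fp : (`|f k x| `^ p) @[k --> \oo] --> (0 : R) by apply: fine_cvg gN.
have pV : 0 < p^-1 by rewrite invr_gt0.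
have := powR_seq_cvg0 _ p^-1 pV (fun n => powR_ge0 _ _) fp.
rewrite (_ : (fun n => _) = (fun n => `|f n x|)).
  by move=> /norm_cvg0P.
by apply/funext => n; rewrite -powRrM mulfV ?gt_eqF// powRr1.
Qed.

End AeSubsequence.

(** * The lim-inf inequality *)

Section LimInf.
Context {R : realType}.
Notation mu := (@lebesgue_measure R).

(** For [c] above the lower limit, choose a subsequence with energies below [c]
    and W^{1,p} distances at most 2^-(k+1), so that values and slopes converge
    almost everywhere.  Since mesh^(-alpha) tends to infinity, each convergent
    sequence of slopes eventually stays below the cut-off level; Fatou's lemma
    then bounds the energy of [v] by [c]. *)
Lemma mania_liminf (p alpha : R) (v_ : nat -> R -> R) (v : R -> R) :
  1 <= p -> 0 < alpha -> fe_family v_ -> in_W1p p v -> cvg_W1p p v_ v ->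
  (J v <= limn_einf (fun N => Jh (mesh N) alpha (v_ N)))%E.
Proof.
move=> p1 a0 fe [_ [w vw _]] cW; have p0 : 0 < p by exact: lt_le_trans p1.
have mI := @measurable_I01 R.
apply: le_of_forall_lt_le => c /limn_einf_lt_frequently freq.
have ex k : exists N, [/\ (k < N)%N, (Jh (mesh N) alpha (v_ N) < c)%E &
    (W1p_norm p (v_ N \- v)%R <= (1 / (2 ^ k.+1)%:R)%:E)%E].
  have e0 : (0 < (1 / (2 ^ k.+1)%:R : R)%:E)%E.
    by rewrite lte_fin divr_gt0// ltr0n expn_gt0.
  have : \forall N \near \oo, (W1p_norm p (v_ N \- v)%R <= (1 / (2 ^ k.+1)%:R)%:E)%E.
    by apply: limn_esup_lt_near; have [_ ->] := cvg_limn_einf_sup cW.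
  move=> [N0 _ HN0]; have [N Nm NJ] := freq (maxn N0 k.+1).
  exists N; split => //; first by apply: leq_trans Nm; exact: leq_maxr.
  by apply: HN0 => /=; apply: leq_trans Nm; exact: leq_maxl.
have /choice[N_ HN] := ex.
have Npos k : (0 < N_ k)%N by have [+ _ _] := HN k; exact: leq_ltn_trans.
have /choice[s_ Hs] k : exists s, is_weak_derivative (v_ (N_ k)) (stepfun (N_ k) s).
  by apply: fe_space_weak_derivative => //; exact: fe.
have vwd := wderivP _ _ vw.
have vkd k := wderivP _ _ (Hs k).
have dkd k := weak_derivativeB _ _ _ _ (vkd k) vwd.
have mwv : measurable_fun (I01 : set R) (wderiv v) by have [_ [] ] := vwd.
have mv : measurable_fun (I01 : set R) v by have [[] ] := vwd.
have mwk k : measurable_fun (I01 : set R) (wderiv (v_ (N_ k))) by have [_ [] ] := vkd k.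
have mvk k : measurable_fun (I01 : set R) (v_ (N_ k)) by have [[] ] := vkd k.
have small k (u : R -> R) : (Lp_norm p u <= W1p_norm p (v_ (N_ k) \- v)%R)%E ->
    (\int[mu]_(x in I01) (`|u x| `^ p)%:E <= (1 / (2 ^ k.+1)%:R)%:E)%E.
  move=> H; have [_ _ Hk] := HN k; have {}H := le_trans H Hk.
  rewrite -Lp_norm_pow ?gt_eqF//; set e := 1 / _ in H *.
  have e0 : 0 < e by rewrite /e divr_gt0// ltr0n expn_gt0.
  have e1 : e <= 1.
    by rewrite /e ler_pdivrMr ?ltr0n ?expn_gt0// mul1r ler1n expn_gt0.
  apply: (@le_trans _ _ (e%:E `^ p)%E).
    apply: gt0_ler_poweR => //; first exact: ltW.
    - by rewrite in_itv/= Lp_norm_ge0 leey.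
    - by rewrite in_itv/= lee_fin ltW//= leey.
  rewrite poweR_EFin lee_fin -[leRHS](@powRr1 _ e) ?(ltW e0)//.
  by apply: ger_powR => //; rewrite e0.
have ae1 : {ae mu, forall x, I01 x -> (v_ (N_ k) x - v x) @[k --> \oo] --> (0 : R)}.
  apply: (Lp_fast_cvg_ae (fun k => v_ (N_ k) \- v) p p0) => k.
    exact: measurable_funB.
  by apply: small; rewrite /W1p_norm leeDl// Lp_norm_ge0.
have ae2 : {ae mu, forall x, I01 x ->
    (wderiv (v_ (N_ k)) x - wderiv v x) @[k --> \oo] --> (0 : R)}.
  have : {ae mu, forall x, I01 x -> wderiv (v_ (N_ k) \- v) x @[k --> \oo] --> (0 : R)}.
    apply: (Lp_fast_cvg_ae (fun k => wderiv (v_ (N_ k) \- v)) p p0) => k.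
      by have [_ [] ] := wderivP _ _ (dkd k).
    by apply: small; rewrite /W1p_norm leeDr// Lp_norm_ge0.
  have : {ae mu, forall x k, I01 x ->
      wderiv (v_ (N_ k) \- v) x = wderiv (v_ (N_ k)) x - wderiv v x}.
    by apply: ae_foralln => k; exact: wderiv_ae (dkd k).
  apply: ae_imply2 => x E C x01; apply: cvg_trans (C x01); apply: near_eq_cvg.
  by apply: nearW => k /=; rewrite E.
pose F k x := ((chi (mesh (N_ k)) alpha (wderiv (v_ (N_ k)) x)) ^+ 6 *
   (v_ (N_ k) x ^+ 3 - x) ^+ 2)%:E.
have mcube (u : R -> R) : measurable_fun (I01 : set R) u ->
    measurable_fun (I01 : set R) (fun x => (u x ^+ 3 - x) ^+ 2).
  move=> mu_; apply: measurable_funX; apply: measurable_funB => //.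
  exact: measurable_funX.
have mF k : measurable_fun (I01 : set R) (F k).
  apply/measurable_EFinP; apply: measurable_funM; last exact: mcube.
  by apply: measurable_funX; exact: (measurableT_comp (measurable_chi _ _)).
have F0 k x : (0 <= F k x)%E by rewrite lee_fin mulr_ge0 ?exprn_even_ge0.
have meshN0 : (mesh (N_ k) : R) @[k --> \oo] --> (0 : R).
  apply: (@squeeze_cvgr _ _ _ _ (cst 0) (fun k => mesh k.+1)) => //.
  - apply: nearW => k; rewrite ltW ?mesh_gt0//= /mesh lef_pV2 ?posrE ?ltr0n//.
    by rewrite ler_nat; have [] := HN k.
  - exact: cvg_cst.
  - exact: cvg_harmonic.
have meshNa := powR_seq_cvg0 _ alpha a0 (fun k => ltW (mesh_gt0 _ (Npos k))) meshN0.
have aeF : {ae mu, forall x, I01 x -> F k x @[k --> \oo] -->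
    (wderiv v x ^+ 6 * (v x ^+ 3 - x) ^+ 2)%:E}.
  apply: (ae_imply2 _ _ _ _ ae1 ae2) => x H1 H2 x01.
  have {}H1 : v_ (N_ k) x @[k --> \oo] --> v x.
    by have := H1 x01; move/subr_cvg0.
  have {}H2 : wderiv (v_ (N_ k)) x @[k --> \oo] --> wderiv v x.
    by have := H2 x01; move/subr_cvg0.
  have H3 : chi (mesh (N_ k)) alpha (wderiv (v_ (N_ k)) x) @[k --> \oo] --> wderiv v x.
    apply: cvg_trans (H2); apply: near_eq_cvg.
    pose K := `|wderiv v x| + 1; have K0 : 0 < K by rewrite ltr_wpDl.
    near=> k; rewrite chi_id//.
    have e1 : `|wderiv (v_ (N_ k)) x| <= K.
      rewrite /K -(subrK (wderiv v x) (wderiv _ x)) (le_trans (ler_normD _ _))//.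
      rewrite addrC lerD2l distrC; near: k.
      by move/cvgrPdist_le : H2; apply.
    apply: le_trans e1 _; rewrite powRN -[leLHS]invrK lef_pV2 ?posrE ?invr_gt0//.
      have : `|0 - mesh (N_ k) `^ alpha| <= K^-1.
        by near: k; move/cvgrPdist_le : meshNa; apply; rewrite invr_gt0.
      by rewrite sub0r normrN ger0_norm// powR_ge0.
    by rewrite powR_gt0// mesh_gt0.
  apply: cvg_EFin; first exact: nearW.
  have cvgX (u : nat -> R) (l : R) m : u k @[k --> \oo] --> l ->
      (u k ^+ m) @[k --> \oo] --> l ^+ m.
    move=> ul; apply: (@continuous_cvg _ _ _ _ _ u (fun y : R => y ^+ m) l) => //.
    exact: exprn_continuous.
  apply: cvgM; first exact: cvgX.
  by apply: (cvgX (fun k => _ - x)); apply: cvgB; [exact: cvgX|exact: cvg_cst].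
have JE : (J v <= \int[mu]_(x in I01) limn_einf (F^~ x))%E.
  apply: ae_ge0_le_integral => //.
  - by move=> x _; rewrite lee_fin mulr_ge0 ?exprn_even_ge0.
  - apply/measurable_EFinP; apply: measurable_funM; last exact: mcube.
    exact: measurable_funX.
  - by move=> x _; apply: le_limn_einf_near; apply: nearW.
  - rewrite /limn_einf; apply: measurableT_comp => //.
    apply: (@measurable_fun_limn_esup _ _ _ _ (fun k x => - F k x)%E) => k.
    exact: measurableT_comp.
  - by apply: ae_imply aeF => x H x01; have [-> _] := cvg_limn_einf_sup (H x01).
apply: le_trans JE _; apply: le_trans (@fatou _ _ _ mu _ mI _ mF (fun k x _ => F0 k x)) _.
apply: le_trans (limn_einf_sup _) _.
apply: (@limn_esup_le_cvg_near _ _ (cst c)); last exact: cvg_cst.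
by apply: nearW => k; have [_ /ltW] := HN k.
Unshelve. all: by end_near. Qed.

End LimInf.

Theorem theorem4p4 (R : realType) (s p alpha : R)
    (hs0 : 0 < s) (hs1 : s < 1 / 3%:R)
    (hp1 : 1 < p) (hp2 : p < 3%:R / 2%:R)
    (hsp : (2%:R / 3%:R + s) * p < 1)
    (ha0 : 0 < alpha)
    (ha1 : alpha < Num.min ((1 + s) / 6%:R) (s / 5%:R)) :
  (* lim-inf property *)
  (forall (v_ : nat -> R -> R) (v : R -> R),
      fe_family v_ -> in_W1p p v -> cvg_W1p p v_ v ->
      (J v <= limn_einf (fun N => Jh (mesh N) alpha (v_ N)))%E)
  /\
  (* recovery sequence property *)
  (forall v : R -> R, X s p v ->
      exists v_ : nat -> R -> R,
        [/\ fe_family v_, cvg_W1p p v_ v &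
            (limn_esup (fun N => Jh (mesh N) alpha (v_ N)) <= J v)%E]).
Proof.
split; first by move=> v_ v; apply: mania_liminf => //; exact: ltW.
move: ha1; rewrite lt_min => /andP[ha6 ha5].
move=> v [[_ cv v0 v1 Jfin] [_ [w0 vw0 [w0Lp gag0]]]].
have p0 : 0 < p by exact: lt_trans hp1.
have mI := @measurable_I01 R.
(* Extension by zero makes the weak derivative measurable on the whole line
   without changing it on (0, 1). *)
pose w := w0 \_ (I01 : set R).
have wE x : I01 x -> w x = w0 x by move=> x01; rewrite /w patchE mem_set.
have mw : measurable_fun setT w := in_Lp_measurable _ _ w0Lp.
have gag : (gagliardo s p w < +oo)%E.
  suff -> : gagliardo s p w = gagliardo s p w0 by exact: gag0.
  rewrite /gagliardo.
  apply: eq_integral => x /set_mem x01; apply: eq_integral => y /set_mem y01.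
  by rewrite (wE x x01) (wE y y01).
have wp : (\int[lebesgue_measure]_(x in I01) (`|w x| `^ p)%:E < +oo)%E.
  suff -> : (\int[lebesgue_measure]_(x in I01) (`|w x| `^ p)%:E =
      \int[lebesgue_measure]_(x in I01) (`|w0 x| `^ p)%:E)%E.
    exact: in_Lp_integral w0Lp.
  by apply: eq_integral => x /set_mem x01; rewrite (wE x x01).
have iw : (@lebesgue_measure R).-integrable `[0, 1] (EFin \o w).
  exact: (Lp_integrable01 _ _ mw (ltW hp1) wp).
have vw : is_weak_derivative v w.
  have [lv lw0 H] := vw0; split => //.
  - apply: open_integrable_locally; first exact: itv_open.
    apply: (@integrableS _ _ _ lebesgue_measure `[0, 1]) => //.
    exact: subset_itv_oo_cc.
  - move=> phi tphi; rewrite H//; congr (- _).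
    by apply: eq_Rintegral => x /set_mem x01; rewrite wE.
exists (fun N => interp N w 0); split.
- by move=> N N0; exact: interp_fe_space.
- exact: interp_cvg_W1p (ltW hp1) cv v0 vw mw iw gag.
- have [B1 [B2 HB]] := interp_energy_le s p alpha v w hs0 (ltW hp1) cv v0 vw mw iw gag.
  pose t N := (B1 * mesh N `^ (s - 5 * alpha) + B2 * mesh N `^ (1 + s - 6 * alpha)).
  apply: (@limn_esup_le_cvg_near _ _ (fun N => J v + (t N)%:E)%E).
    by exists 1%N => // N /= N0; exact: HB.
  rewrite -[X in _ --> X]adde0; apply: cvgeD; first exact: fin_num_adde_defl.
    exact: cvg_cst.
  apply: cvg_EFin; first exact: nearW.
  rewrite [X in _ --> X](_ : _ = B1 * 0 + B2 * 0); last by rewrite !mulr0 addr0.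
  (* Both exponents are positive because alpha < s/5 and alpha < (1 + s)/6. *)
  by apply: cvgD; apply: cvgMl_tmp; apply: mesh_powR_cvg0; lra.
Qed.
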